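(* Let $M,N,m\ge1$ be integers, and let $\tau_0\in\mathcal F_0$, $\tau_1^{(i)}\in\mathcal F_{1}$, $\tau_{-1}^{(i)}\in\mathcal F_{-1}$ ($1\le i\le m$) satisfy the fermionic $(M+N,m)$-constrained KP hierarchy $$\Omega_{(M+N)}(\tau_0\otimes\tau_0)=\sum_{i=1}^m\tau_1^{(i)}\otimes\tau_{-1}^{(i)},\qquad \Omega_{(0)}(\tau_0\otimes\tau_1^{(i)})=\tau_1^{(i)}\otimes\tau_0,\qquad \Omega_{(0)}(\tau_{-1}^{(i)}\otimes\tau_0)=\tau_0\otimes\tau_{-1}^{(i)}\quad(1\le i\le m).$$ Write, using the two-component bosonization $\sigma_2$ associated with $(M,N)$, $$\sigma_2(\tau_0)=\sum_{n\in\mathbb Z}(-1)^{\frac{n(n-1)}2}Q_1^nQ_2^{-n}\tau_{0,n}(\mathbf t),\qquad \sigma_2(\tau_{\pm1}^{(i)})=\sum_{n\in\mathbb Z}(-1)^{\frac{n(n-1)}2}Q_1^{n\pm1}Q_2^{-n}\tau^{(i)}_{\pm1,n}(\mathbf t).$$ Then for all $n',n''\in\mathbb Z$, all $\mathbf t',\mathbf t''$ and all $1\le i\le m$: \begin{align*} &\oint_{C_R}\frac{dz}{2\pi\mathbf i}z^{M+n'-n''}\tau_{0,n'}(\mathbf t'-[z^{-1}]_1)\tau_{0,n''}(\mathbf t''+[z^{-1}]_1)e^{\xi(t^{(1)'}-t^{(1)''},z)}\\ &\quad=\oint_{C_r}\frac{dz}{2\pi\mathbf i}z^{-N+n'-n''}\tau_{0,n'+1}(\mathbf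 t'-[z]_2)\tau_{0,n''-1}(\mathbf t''+[z]_2)e^{\xi(t^{(2)'}-t^{(2)''},z^{-1})}+\sum_{l=1}^m\tau^{(l)}_{1,n'}(\mathbf t')\tau^{(l)}_{-1,n''}(\mathbf t''),\\ &\oint_{C_R}\frac{dz}{2\pi\mathbf i}z^{n'-n''-1}\tau_{0,n'}(\mathbf t'-[z^{-1}]_1)\tau^{(i)}_{1,n''}(\mathbf t''+[z^{-1}]_1)e^{\xi(t^{(1)'}-t^{(1)''},z)}\\ &\quad=-\oint_{C_r}\frac{dz}{2\pi\mathbf i}z^{n'-n''}\tau_{0,n'+1}(\mathbf t'-[z]_2)\tau^{(i)}_{1,n''-1}(\mathbf t''+[z]_2)e^{\xi(t^{(2)'}-t^{(2)''},z^{-1})}+\tau^{(i)}_{1,n'}(\mathbf t')\tau_{0,n''}(\mathbf t''),\\ &\oint_{C_R}\frac{dz}{2\pi\mathbf i}z^{n'-n''-1}\tau^{(i)}_{-1,n'}(\mathbf t'-[z^{-1}]_1)\tau_{0,n''}(\mathbf t''+[z^{-1}]_1)e^{\xi(t^{(1)'}-t^{(1)''},z)}\\ &\quad=-\oint_{C_r}\frac{dz}{2\pi\mathbf i}z^{n'-n''}\tau^{(i)}_{-1,n'+1}(\mathbf t'-[z]_2)\tau_{0,n''-1}(\mathbf t''+[z]_2)e^{\xi(t^{(2)'}-t^{(2)''},z^{-1})}+\tau_{0,n'}(\mathbf t')\tau^{(i)}_{-1,n''}(\mathbf t''). \end{align*}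
   Context: Fermions: $\psi^\pm_j$ ($j\in\mathbb Z+1/2$) are charged free fermions, $\psi_j^\lambda\psi_l^\mu+\psi_l^\mu\psi_j^\lambda=\delta_{\lambda+\mu,0}\delta_{j+l,0}$ ($\lambda,\mu=\pm$). The fermionic Fock space $\mathcal F$ is spanned by $\psi^+_{i_1}\cdots\psi^+_{i_r}\psi^-_{j_1}\cdots\psi^-_{j_s}|0\rangle$ with $i_1<\dots<i_r<0$, $j_1<\dots<j_s<0$, where $\psi^\pm_s|0\rangle=0$ for $s>0$. Giving $\psi^\pm_j$ charge $\pm1$, $\mathcal F=\bigoplus_{s\in\mathbb Z}\mathcal F_s$ is the decomposition by charge. $\Omega_{(s)}=\sum_{i\in\mathbb Z+1/2}\psi^+_i\otimes\psi^-_{-i+s}$, acting on $\mathcal F\otimes\mathcal F$ by $(A\otimes B)(u\otimes v)=Au\otimes Bv$ (no extra signs). Two-component relabelling for $(M,N)$: for $i\in\mathbb Z$, $0\le p\le M-1$, $0\le q\le N-1$, $\psi^{+(1)}_{-Mi-1/2-p}=\psi^+_{-(M+N)i-1/2-p}$, $\psi^{-(1)}_{Mi+1/2+p}=\psi^-_{(M+N)i+1/2+p}$, $\psi^{+(2)}_{-Ni-1/2-q}=\psi^+_{-(M+N)i-1/2-(M+q)}$, $\psi^{-(2)}_{Ni+1/2+q}=\psi^-_{(M+N)i+1/2+(M+q)}$. Put $\psi^{\pm(a)}(z)=\sum_{j\in\mathbb Z+1/2}\psi^{\pm(a)}_jz^{-j-1/2}$, $a=1,2$. Bosonization: $\sigma_2:\mathcal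 F\to\mathcal B_2=\bigoplus_{l_1,l_2\in\mathbb Z}\mathbb C\,Q_1^{l_1}Q_2^{l_2}\otimes\mathbb C[\mathbf t]$ is the linear isomorphism with $\sigma_2(|0\rangle)=1$ and $\sigma_2\psi^{\pm(a)}(z)\sigma_2^{-1}=Q_a^{\pm1}z^{\pm Q_a\partial_{Q_a}}e^{\pm\xi(t^{(a)},z)}e^{\mp\xi(\tilde\partial_{t^{(a)}},z^{-1})}$, where $Q_1Q_2=-Q_2Q_1$, $Q_a^{\pm1}$ acts by left multiplication, $z^{\pm Q_a\partial_{Q_a}}$ multiplies $Q_1^{l_1}Q_2^{l_2}f(\mathbf t)$ by $z^{\pm l_a}$, and $\tilde\partial_t=(\partial_{t_1},\partial_{t_2}/2,\partial_{t_3}/3,\dots)$. Notation: $\mathbf t=(t^{(1)},t^{(2)})$, $t^{(a)}=(t_1^{(a)},t_2^{(a)},\dots)$, $\xi(t,z)=\sum_{j\ge1}t_jz^j$, $[z]=(z,z^2/2,z^3/3,\dots)$, $\mathbf t\pm[z]_1=(t^{(1)}\pm[z],t^{(2)})$, $\mathbf t\pm[z]_2=(t^{(1)},t^{(2)}\pm[z])$. $C_R$ (resp. $C_r$) is an anticlockwise circle of sufficiently large (resp. small) radius; formally the integrals mean ''coefficient of $z^{-1}$'', with exponentials expanded in powers of $\mathbf t'-\mathbf t''$ and shifts by $[z^{-1}]_1$ expanded in $z^{-1}$, shifts by $[z]_2$ expanded in $z$. *)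

(* Defs.v *)
From HB Require Import structures.
From mathcomp Require Import all_boot all_order all_algebra.
From mathcomp Require Import finmap.
From mathcomp Require Import boolp classical_sets cardinality fsbigop reals.
From mathcomp Require Import complex monalg.

Set Implicit Arguments.
Unset Strict Implicit.
Unset Printing Implicit Defensive.

Import GRing.Theory.

Local Open Scope classical_set_scope.
Local Open Scope ring_scope.

(* Conventions.
   - A half-integer j is encoded by the integer a with j = a + 1/2.
   - A sign is a boolean: true is +, false is -.
   - A component is a boolean: false is the component 1, true the component 2.
   - The times t_1, t_2, ... of a component are indexed by nat: the index k
     stands for t_(k+1).
   - A sum \sum_(i \in [set: I]) F i is the sum of a family with finitely many
     nonzero terms (this is the case of all the sums below). *)

Definition sgz_of (lam : bool) : int := if lam then 1 else -1.

Section Fermions.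
Variable C : numFieldType.

(* (lam, k) is the creation operator psi^lam_{-k-1/2} *)
Definition mode : choiceType := (bool * nat)%type.

(* The order of the creation operators in the basis monomials
   psi^+_{i_1} ... psi^+_{i_r} psi^-_{j_1} ... psi^-_{j_s} |0>,
   i_1 < ... < i_r < 0, j_1 < ... < j_s < 0. *)
Definition before (x y : mode) : bool :=
  if x.1 == y.1 then (y.2 < x.2)%N else x.1.

(* << S >> is the above monomial in the creation operators belonging to S *)
Definition fock := {malg C[{fset mode}]}.

Definition vac : fock := << fset0 >>.

Definition mode_sign (x : mode) (S : {fset mode}) : C :=
  (-1) ^+ #|` [fset y in S | before y x]%fset |.

(* psi^lam_j, j = a + 1/2, on the monomial << S >>: for j < 0 it adds a creation
   operator, for j > 0 it contracts with psi^{-lam}_{-j}. *)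
Definition psi_basis (lam : bool) (a : int) (S : {fset mode}) : fock :=
  match a with
  | Negz k => let x := (lam, k) in
      if x \in S then 0 else << mode_sign x S *g (x |` S)%fset >>
  | Posz k => let x := (~~ lam, k) in
      if x \in S then << mode_sign x S *g (S `\ x)%fset >> else 0
  end.

Definition psi (lam : bool) (a : int) (u : fock) : fock :=
  \sum_(S <- msupp u) u@_S *: psi_basis lam a S.

Definition charge (S : {fset mode}) : int := \sum_(x <- S) sgz_of x.1.

(* u belongs to F_s *)
Definition has_charge (s : int) (u : fock) : Prop :=
  forall S, S \in msupp u -> charge S = s.

Definition fock2 := {malg C[({fset mode} * {fset mode})%type]}.

Definition tens (u v : fock) : fock2 :=
  \sum_(S <- msupp u) \sum_(T <- msupp v) << u@_S * v@_T *g (S, T) >>.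

(* (A (x) B)(u (x) v) = A u (x) B v, for linear A and B *)
Definition tens_op (A B : fock -> fock) (w : fock2) : fock2 :=
  \sum_(k <- msupp w) w@_k *: tens (A << k.1 >>) (B << k.2 >>).

(* With i = a + 1/2, the half-integer - i + s is encoded by s - 1 - a. *)
Definition Omega (s : int) (w : fock2) : fock2 :=
  \sum_(a \in [set: int]) tens_op (psi true a) (psi false (s - 1 - a)) w.

(* psi^{-(c)}_{b+1/2} = psi^-_{b'+1/2}, where b' = relabel M N c b:
   M i + p |-> (M + N) i + p for c = 1, N i + q |-> (M + N) i + M + q for c = 2. *)
Definition relabel (M N : nat) (c : bool) (b : int) : int :=
  if c then (M + N)%:Z * (b %/ N)%Z + (M%:Z + (b %% N)%Z)
       else (M + N)%:Z * (b %/ M)%Z + (b %% M)%Z.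

(* - (a + 1/2) is encoded by -1 - a *)
Definition psi_comp (M N : nat) (c lam : bool) (a : int) : fock -> fock :=
  if lam then psi true (-1 - relabel M N c (-1 - a))
         else psi false (relabel M N c a).

End Fermions.

Section Exponential.
Variables (C : numFieldType) (V : lmodType C).

(* Multiplication of the power series \sum_k g_k z^k by
   xi(x, z) = \sum_(j >= 1) x_j z^j, where x_1, x_2, ... are operators on V
   (x_(j+1) is x j). *)
Definition xi_act (x : nat -> V -> V) (g : nat -> V) : nat -> V :=
  fun k => \sum_(j < k) x j (g (k - j.+1)%N).

(* The coefficient of z^k in e^{xi(x, z)} v = \sum_r xi(x, z)^r v / r!; the
   terms with r > k do not contribute to it. *)
Definition exp_xi (x : nat -> V -> V) (v : V) : nat -> V :=
  fun k => \sum_(r < k.+1) (r`!%:R)^-1 *: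
    iter r (xi_act x) (fun i => if i == 0%N then v else 0) k.

End Exponential.

Section Distributions.
Variable V : nmodType.

(* The Laurent series in z, resp. z^-1, with given coefficients, as
   a formal distribution: f n is the coefficient of z^n in f. *)
Definition in_z (g : nat -> V) : int -> V :=
  fun n => if n is Posz k then g k else 0.

Definition in_zinv (g : nat -> V) : int -> V := fun n => in_z g (- n).

(* z^k f(z) *)
Definition zpow (k : int) (f : int -> V) : int -> V := fun n => f (n - k).

(* (2 pi i)^-1 \oint f(z) dz *)
Definition res (f : int -> V) : V := f (-1).

End Distributions.

Definition fdmul (A : pzRingType) (f g : int -> A) : int -> A :=
  fun n => \sum_(i \in [set: int]) f i * g (n - i).

Section Bosons.
Variable C : numFieldType.

(* C[t]: the variable (a, k) is t^(a)_(k+1) *)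
Definition tpoly := {malg C[{cmonom (bool * nat)%type}]}.

Definition tvar (a : bool) (k : nat) : tpoly := << ucm (a, k) >>.

Definition tderiv (a : bool) (k : nat) (f : tpoly) : tpoly :=
  \sum_(m <- msupp f) << f@_m *+ m (a, k) *g divcm m (ucm (a, k)) >>.

(* The coefficient at (l1, l2) is that of Q_1^l1 Q_2^l2. *)
Definition boson := {malg tpoly[(int * int)%type]}.

(* Q_a^{+-1} Q_1^l1 Q_2^l2 = Qsign a l Q_1^l1' Q_2^l2', with
   (l1', l2') = Qshift a (+-1) l, because Q_1 Q_2 = - Q_2 Q_1. *)
Definition Qsign (a : bool) (l : int * int) : C := if a then (-1) ^ l.1 else 1.

Definition Qshift (a : bool) (e : int) (l : int * int) : int * int :=
  if a then (l.1, l.2 + e) else (l.1 + e, l.2).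

Definition Qdeg (a : bool) (l : int * int) : int := if a then l.2 else l.1.

(* e^{lam xi(t^(a), z)} e^{- lam xi(dtilde, z^-1)} f *)
Definition vertex_exp (lam a : bool) (f : tpoly) : int -> tpoly :=
  let e : C := (sgz_of lam)%:~R in
  let lower : nat -> tpoly :=
    exp_xi (fun j (g : tpoly) => (- e / j.+1%:R) *: tderiv a j g) f in
  fun n => \sum_(q \in [set: nat])
    in_z (exp_xi (fun j (g : tpoly) => (e *: tvar a j) * g) (lower q)) (n + q%:Z).

(* The coefficient of z^n in
   Q_a^lam z^{lam Q_a d/dQ_a} e^{lam xi(t^(a), z)} e^{- lam xi(dtilde, z^-1)} b. *)
Definition vertex (lam a : bool) (n : int) (b : boson) : boson :=
  \sum_(l <- msupp b)
    << Qsign a l *: zpow (sgz_of lam * Qdeg a l) (vertex_exp lam a b@_l) n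
       *g Qshift a (sgz_of lam) l >>.

(* sigma is sigma_2. As psi^{lam(c)}(z) = \sum_a psi^{lam(c)}_{a+1/2} z^{-a-1},
   the last condition is the equality of the coefficients of z^{-a-1} in
   sigma psi^{lam(c)}(z) = (vertex operator) sigma. *)
Definition bosonization (M N : nat) (sigma : fock C -> boson) : Prop :=
  [/\ forall (x : C) (u v : fock C),
        sigma (x *: u + v) = (x%:MP : tpoly) *: sigma u + sigma v,
      bijective sigma,
      sigma (vac C) = << (1 : tpoly) *g (0, 0) >>
    & forall (c lam : bool) (a : int) (u : fock C),
        sigma (psi_comp M N c lam a u) = vertex lam c (-1 - a) (sigma u)].

(* b = \sum_n (-1)^{n(n-1)/2} Q_1^{n+s} Q_2^{-n} tau_n(t) *)
Definition expansion (s : int) (b : boson) (tau : int -> tpoly) : Prop :=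
  finite_set [set n | tau n != 0] /\
  b = \sum_(n \in [set: int])
        << ((-1 : C) ^ (n * (n - 1) %/ 2)%Z) *: tau n *g (n + s, - n) >>.

(* The variable (a, k) is replaced by x a k and a scalar c by iota c. *)
Definition tsubst (A : comNzRingType) (iota : C -> A) (x : bool -> nat -> A)
    (f : tpoly) : A :=
  mmap iota (fun m : {cmonom (bool * nat)%type} =>
    \prod_(v <- finsupp (cmonom_val m)) x v.1 v.2 ^+ m v) f.

(* f(t) *)
Definition teval (t : bool -> nat -> C) (f : tpoly) : C := tsubst idfun t f.

(* f(t + e [X]_a), a polynomial in X *)
Definition tshift (a : bool) (e : C) (t : bool -> nat -> C) (f : tpoly) :
    {poly C} :=
  tsubst polyC (fun b k => (t b k)%:P +
    (if b == a then (e / k.+1%:R) *: 'X^(k.+1) else 0)) f.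

Definition exp_xi_num (x : nat -> C) : nat -> C :=
  exp_xi (fun j (g : C^o) => x j * g) 1.

(* The integral over C_R of
   z^k f(t' - [z^-1]_1) g(t'' + [z^-1]_1) e^{xi(t^(1)' - t^(1)'', z)}. *)
Definition oint_R (k : int) (f g : tpoly) (t' t'' : bool -> nat -> C) : C :=
  let P := tshift false (-1) t' f * tshift false 1 t'' g in
  res (zpow k (fdmul
    (in_zinv (fun q => P`_q))
    (in_z (exp_xi_num (fun j => t' false j - t'' false j))))).

(* The integral over C_r of
   z^k f(t' - [z]_2) g(t'' + [z]_2) e^{xi(t^(2)' - t^(2)'', z^-1)}. *)
Definition oint_r (k : int) (f g : tpoly) (t' t'' : bool -> nat -> C) : C :=
  let P := tshift true (-1) t' f * tshift true 1 t'' g in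
  res (zpow k (fdmul
    (in_z (fun q => P`_q))
    (in_zinv (exp_xi_num (fun j => t' true j - t'' true j))))).

End Bosons.

(* Main.v *)
(** Taking the coefficient of fixed powers of Q_1 and Q_2 in each factor of
    sigma_2 (x) sigma_2 and evaluating it at t' and t'' is a linear functional on
    F (x) F.  Relabelling splits Omega into a sum over the two components, and in each
    of them bosonization turns the sum over modes into the coefficient of a product of
    two vertex operators.  By Taylor's formula a vertex operator acts as
    f |-> e^{xi(t, z)} f(t - [z^-1]), so that this coefficient is one of the contour
    integrals, once e^{xi(x, z)} e^{xi(y, z)} = e^{xi(x + y, z)} is known.  The signs
    come from Q_1 Q_2 = - Q_2 Q_1 and from the factors (-1)^{n(n-1)/2}. *)
Require Import Defs.
From HB Require Import structures.
From mathcomp Require Import all_boot all_order all_algebra.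
From mathcomp Require Import finmap boolp classical_sets cardinality fsbigop.
From mathcomp Require Import reals complex monalg.
From mathcomp Require Import ring zify.

Set Implicit Arguments.
Unset Strict Implicit.
Unset Printing Implicit Defensive.

Import Order.TTheory GRing.Theory Num.Theory.
Local Open Scope ring_scope.

(** * The exponential of xi *)

Section ExpXi.
Variable C : numFieldType.

(** [exp_xi] is a sum of iterates of [xi_act], a form that shows neither Taylor's formula nor the
    addition rule. Both are reached through the Euler operator [z d/dz]: [k] times the coefficient
    of [z^k] in [e^{xi(x, z)}] is the sum over [j < k] of [(j+1) x_{j+1}] applied to the coefficient
    of [z^{k-j-1}]. In characteristic 0 this recursion and the constant term determine the series,
    and the shifts [f(t + e [z])] obey the same recursion by the chain rule. The sums over all
    integers are the other obstacle: such a sum is 0 by convention when infinitely many terms are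
    nonzero, so each splitting, exchange or transport by a functional is accompanied by a proof of
    finite support. Shifted functions are polynomials in the shift parameter. This turns both
    contour integrals into finite pairings of the coefficients of a polynomial with those of one
    exponential, the form in which they meet the sums over modes. *)

Lemma linear_bundle (V W : lmodType C) (f : V -> W) :
  linear f -> exists g : {linear V -> W}, f =1 g.
Proof.
move=> fl; pose g : {linear V -> W} :=
  HB.pack f (GRing.isLinear.Build C V W *:%R f fl).
by exists g.
Qed.

(** A linear map that intertwines [x j] with [y j] intertwines all iterates of [xi_act]. With [f] an
    evaluation, this turns operators on polynomials into numbers; with [f] one of the [x j], it
    moves that operator inside the exponential. *)
Lemma exp_xi_natural (V W : lmodType C) (f : V -> W)
    (x : nat -> V -> V) (y : nat -> W -> W) (v : V) (k : nat) :
  linear f -> (forall j u, f (x j u) = y j (f u)) ->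
  f (exp_xi x v k) = exp_xi y (f v) k.
Proof.
move=> /linear_bundle[g fg] fxy; rewrite /exp_xi fg linear_sum /=.
apply: eq_bigr => r _; rewrite linearZ /= -fg; congr (_ *: _).
move: {r}(nat_of_ord r) => r; elim: r k => [|n IHn] k /=.
  by case: ifP; rewrite ?fg ?linear0.
rewrite /xi_act [LHS]fg linear_sum /=; apply: eq_bigr => j _.
by rewrite -fg fxy IHn.
Qed.

Lemma exchange_triangle (V : nmodType) (F : nat -> nat -> V) (k : nat) :
  \sum_(j < k) \sum_(i < k - j.+1) F i j
  = \sum_(j < k) \sum_(i < k - j.+1) F j i.
Proof.
have E (G : nat -> nat -> V) : \sum_(j < k) \sum_(i < k - j.+1) G i j
         = \sum_(j < k) \sum_(i < k | (i + j.+1 < k)%N) G i j.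
  apply: eq_bigr => j _.
  rewrite (big_ord_widen k (G^~ j)) ?leq_subr //.
  by apply: eq_bigl => i; rewrite ltn_subRL addnC.
rewrite (E F) (E (fun i j => F j i)) (exchange_big_dep xpredT) //=.
by apply: eq_bigr => j _; apply: eq_bigl => i; rewrite addnC addSnnS.
Qed.

(** * The Euler operator and the recursion for the coefficients of the exponential *)

Section Recursion.
Variables (V : lmodType C) (x : nat -> V -> V).
Hypothesis x_linear : forall j, linear (x j).
Hypothesis xC : forall i j v, x i (x j v) = x j (x i v).

(** [xi_act dx] is multiplication by the series [z d/dz xi(x, z)]. *)
Let dx (j : nat) (v : V) : V := j.+1%:R *: x j v.
Let delta (v : V) : nat -> V := fun i => if i == 0%N then v else 0.

Let x_sum j (I : Type) (r : seq I) (F : I -> V) :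
  x j (\sum_(i <- r) F i) = \sum_(i <- r) x j (F i).
Proof.
have [g gE] := linear_bundle (x_linear j).
by rewrite gE linear_sum; apply: eq_bigr => i _; rewrite gE.
Qed.

Let xZ j c v : x j (c *: v) = c *: x j v.
Proof. by have [g gE] := linear_bundle (x_linear j); rewrite !gE linearZ. Qed.

Let x0 j : x j 0 = 0.
Proof. by have [g gE] := linear_bundle (x_linear j); rewrite !gE linear0. Qed.

Lemma xi_actC (g : nat -> V) k :
  xi_act x (xi_act dx g) k = xi_act dx (xi_act x g) k.
Proof.
rewrite /xi_act.
under eq_bigr => j _ do rewrite x_sum.
under [RHS]eq_bigr => j _ do rewrite /dx x_sum scaler_sumr.
rewrite (exchange_triangle
  (fun i j => x j (dx i (g (k - j.+1 - i.+1)%N)))).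
apply: eq_bigr => j _; apply: eq_bigr => i _.
rewrite /dx xZ xC; congr (_ *: x _ (x _ (g _))).
by rewrite !subnS -!subn1 -!subnDA; congr subn; lia.
Qed.

Lemma iter_xi_act_small v r i : (i < r)%N -> iter r (xi_act x) (delta v) i = 0.
Proof.
elim: r i => // r IHr i ir /=; rewrite /xi_act big1 // => j _.
rewrite IHr ?x0 //; have := ltn_ord j; lia.
Qed.

(* Commutation of the Euler operator z d/dz with xi(x, z)^r. *)
Lemma euler_iter_xi_act v r k :
  k%:R *: iter r.+1 (xi_act x) (delta v) k
  = r.+1%:R *: xi_act dx (iter r (xi_act x) (delta v)) k.
Proof.
elim: r k => [|r IHr] k.
  rewrite /= /xi_act scaler_sumr scaler_sumr; apply: eq_bigr => j _.
  rewrite /dx /delta subn_eq0; case: leqP => jk; last by rewrite x0 !scaler0.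
  by rewrite scale1r; congr (_%:R *: _); have := ltn_ord j; lia.
rewrite -[in RHS](addn1 r.+1) natrD scalerDl scale1r.
rewrite [in RHS]/= -xi_actC [iter r.+2 _ _ _]/= {1}/xi_act scaler_sumr.
have -> : r.+1%:R *: xi_act x (xi_act dx (iter r (xi_act x) (delta v))) k
    = \sum_(j < k) x j ((k - j.+1)%:R *: iter r.+1 (xi_act x) (delta v) (k - j.+1)%N).
  by rewrite /xi_act scaler_sumr; apply: eq_bigr => j _; rewrite IHr xZ.
rewrite xi_actC {2}/xi_act -big_split /=; apply: eq_bigr => j _.
rewrite /dx xZ -scalerDl -natrD; congr (_%:R *: _).
by have := ltn_ord j; lia.
Qed.

(** The coefficient of [z^k] in [z d/dz e^xi = (z d/dz xi) e^xi]: the factor [r+1] produced by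
    differentiating [xi^(r+1)] cancels against [(r+1)!]. *)
Lemma exp_xi_rec v k :
  k%:R *: exp_xi x v k
  = \sum_(j < k) j.+1%:R *: x j (exp_xi x v (k - j.+1)%N).
Proof.
rewrite /exp_xi big_ord_recl scalerDr -/(delta v).
have -> : k%:R *: ((0`!%:R)^-1 *: iter (@ord0 k) (xi_act x) (delta v) k) = 0.
  by rewrite /= /delta; case: k => [|k]; rewrite ?scale0r ?scaler0.
rewrite add0r scaler_sumr.
have -> : \sum_(i < k) k%:R *: (((lift ord0 i)`!%:R)^-1 *:
      iter (lift ord0 i) (xi_act x) (delta v) k)
   = \sum_(r < k) \sum_(j < k) j.+1%:R *: x j ((r`!%:R)^-1 *:
      iter r (xi_act x) (delta v) (k - j.+1)%N).
  apply: eq_bigr => r _; rewrite scalerA mulrC -scalerA lift0.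
  rewrite euler_iter_xi_act scalerA factS natrM invfM mulrAC.
  rewrite mulVf ?mul1r ?pnatr_eq0 // {1}/xi_act scaler_sumr.
  by apply: eq_bigr => j _; rewrite /dx xZ !scalerA mulrC.
rewrite exchange_big /=; apply: eq_bigr => j _; rewrite -scaler_sumr -x_sum.
congr (_ *: x _ _); rewrite -/(delta v).
(* The coefficient of [z^(k-j-1)] only involves [r <= k-j-1]; extending the range to [r < k] adds
   zeros, because [xi^r] starts at [z^r]. *)
have kj : ((k - j.+1).+1 <= k)%N by have := ltn_ord j; lia.
rewrite [RHS](big_ord_widen k (fun r => (r`!%:R)^-1 *:
      iter r (xi_act x) (delta v) (k - j.+1)%N)) // [RHS]big_mkcond /=.
apply: eq_bigr => r _; case: ltnP => // rk.
by rewrite iter_xi_act_small ?scaler0.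
Qed.

(** Since [x j] commutes with the exponential, it can act first. In this form an induction on [k]
    applies to the vectors [x j v]. *)
Lemma exp_xi_rec_r v k :
  k%:R *: exp_xi x v k
  = \sum_(j < k) j.+1%:R *: exp_xi x (x j v) (k - j.+1)%N.
Proof.
rewrite exp_xi_rec; apply: eq_bigr => j _; congr (_ *: _).
by apply: exp_xi_natural => // i u; rewrite xC.
Qed.

End Recursion.

Lemma exp_xi0 (V : lmodType C) (x : nat -> V -> V) v : exp_xi x v 0 = v.
Proof. by rewrite /exp_xi big_ord1 /= invr1 scale1r. Qed.

Lemma exp_xi_num_rec (x : nat -> C) k :
  k%:R * exp_xi_num x k
  = \sum_(j < k) j.+1%:R * (x j * exp_xi_num x (k - j.+1)%N).
Proof.
apply: (@exp_xi_rec C^o (fun j g => x j * g)) => [j a u v|i j v].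
  by rewrite mulrDr /GRing.scale /= mulrCA.
by rewrite mulrCA.
Qed.

Lemma exp_xi_numE (x : nat -> C) (c : C) k :
  exp_xi (fun j (g : C^o) => x j * g) c k = c * exp_xi_num x k.
Proof.
rewrite /exp_xi_num; apply/esym.
have := @exp_xi_natural C^o C^o (fun g => c * g)
   (fun j g => x j * g) (fun j g => x j * g) 1 k.
rewrite mulr1; apply=> [a u v|j u]; last by rewrite mulrCA.
by rewrite mulrDr /GRing.scale /= mulrCA.
Qed.

(* The recursion of exp_xi_num_rec as the differential equation
   P' = (sum_j (j+1) x_j z^j) P modulo z^n. *)
Definition exp_ode (x : nat -> C) (n : nat) (P : {poly C}) :=
  forall i, (i < n)%N ->
    P^`()`_i = ((\poly_(j < n) (j.+1%:R * x j)) * P)`_i.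

Lemma exp_ode_num (x : nat -> C) n :
  exp_ode x n (\poly_(i < n.+1) exp_xi_num x i).
Proof.
move=> i ilt; rewrite coef_deriv coef_poly ltnS ilt -mulr_natl exp_xi_num_rec.
rewrite coefM; apply: eq_bigr => j _.
rewrite !coef_poly subSS mulrA; have := ltn_ord j => ji.
by rewrite (leq_trans ji ilt) ifT // ltnS; lia.
Qed.

Lemma exp_ode_uniq (x : nat -> C) n (P : {poly C}) :
  P`_0 = 1 -> exp_ode x n P -> forall i, (i <= n)%N -> P`_i = exp_xi_num x i.
Proof.
move=> P0 odeP; elim/ltn_ind => -[|i] IHi ilt.
  by rewrite P0 /exp_xi_num exp_xi0.
have ni : (i.+1%:R : C) != 0 by rewrite pnatr_eq0.
apply: (mulfI ni); rewrite exp_xi_num_rec mulr_natl -coef_deriv odeP // coefM.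
apply: eq_bigr => j _; have := ltn_ord j => ji.
rewrite coef_poly (leq_trans ji ilt) mulrA subSS IHi ?subSS //; lia.
Qed.

Lemma eq_coefM_low (A : nzRingType) n (P P' Q : {poly A}) :
  (forall i, (i < n)%N -> P`_i = P'`_i) ->
  forall i, (i < n)%N -> (P * Q)`_i = (P' * Q)`_i.
Proof.
move=> PP i ilt; rewrite !coefM; apply: eq_bigr => j _; rewrite PP //.
by have := ltn_ord j; lia.
Qed.

(** By the Leibniz rule the product of the two exponentials, truncated to polynomials of degree at
    most [k], satisfies modulo [z^k] the differential equation for [x + y]; its constant term is 1,
    and uniqueness concludes. *)
Lemma exp_xi_numD (x y : nat -> C) k :
  \sum_(i < k.+1) exp_xi_num x i * exp_xi_num y (k - i)%N
  = exp_xi_num (fun j => x j + y j) k.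
Proof.
pose A := \poly_(i < k.+1) exp_xi_num x i.
pose B := \poly_(i < k.+1) exp_xi_num y i.
have -> : \sum_(i < k.+1) exp_xi_num x i * exp_xi_num y (k - i)%N = (A * B)`_k.
  rewrite coefM; apply: eq_bigr => i _.
  by rewrite !coef_poly ltn_ord ltnS leq_subr.
apply: (@exp_ode_uniq _ k) => // [|i ilt].
  by rewrite coefM big_ord1 !coef_poly /= /exp_xi_num !exp_xi0 mulr1.
rewrite derivM coefD (eq_coefM_low B (@exp_ode_num x k) ilt).
rewrite [A * _]mulrC (eq_coefM_low A (@exp_ode_num y k) ilt) -coefD.
rewrite -/A -/B.
have -> : \poly_(j < k) (j.+1%:R * (x j + y j))
    = \poly_(j < k) (j.+1%:R * x j) + \poly_(j < k) (j.+1%:R * y j) :> {poly C}.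
  by apply/polyP => j; rewrite coefD !coef_poly; case: ifP; rewrite ?mulrDr ?addr0.
by rewrite -[_ * A * B]mulrA -[_ * B * A]mulrA [B * A]mulrC -mulrDl.
Qed.

End ExpXi.

(** * Sums of finitely supported families and residues *)

Section FiniteSupport.

Definition fin_supp (T : choiceType) (V : nmodType) (F : T -> V) :=
  exists A : {fset T}, forall i, i \notin A -> F i = 0.

Lemma fin_supp_int (V : nmodType) (F : int -> V) (a b : int) :
  (forall k, k < a -> F k = 0) -> (forall k, b < k -> F k = 0) -> fin_supp F.
Proof.
move=> Fa Fb; pose s := [seq a + Posz i | i <- iota 0 `|b - a|%N.+1].
exists [fset x in s]%fset => k ks; case: (ltP k a) => [/Fa//|ak].
case: (ltP b k) => [/Fb//|kb]; case/negP: ks.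
rewrite in_fset; apply/mapP.
by exists `|k - a|%N; rewrite ?mem_iota; lia.
Qed.

Lemma fin_supp_reindex (I J : choiceType) (V : nmodType) (h : I -> J)
    (F : J -> V) : bijective h -> fin_supp F -> fin_supp (F \o h).
Proof.
move=> [g hK gK] [A FA]; exists [fset g x | x in A]%fset => i iA; apply: FA.
apply: contra iA => hA; apply/imfsetP; exists (h i) => //=; by rewrite hK.
Qed.

Variables (T : choiceType) (V : nmodType).
Implicit Types F G : T -> V.

Lemma fsumD F G : fin_supp F -> fin_supp G ->
  \sum_(k \in [set: T]) (F k + G k)
  = \sum_(k \in [set: T]) F k + \sum_(k \in [set: T]) G k.
Proof.
move=> [A FA] [B GB].
have FU i : i \notin (A `|` B)%fset -> F i = 0.
  by rewrite inE negb_or => /andP[/FA].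
have GU i : i \notin (A `|` B)%fset -> G i = 0.
  by rewrite inE negb_or => /andP[_ /GB].
rewrite (fsbigTE _ _ FU) (fsbigTE _ _ GU) -big_split; apply: fsbigTE => i iU /=.
by rewrite FU ?GU ?addr0.
Qed.

Lemma fin_suppD F G : fin_supp F -> fin_supp G -> fin_supp (fun k => F k + G k).
Proof.
move=> [A FA] [B GB]; exists (A `|` B)%fset => i.
by rewrite inE negb_or => /andP[/FA-> /GB->]; rewrite addr0.
Qed.

Lemma fin_supp_sum (I : Type) (r : seq I) (F : I -> T -> V) :
  (forall q, fin_supp (F q)) -> fin_supp (fun k => \sum_(q <- r) F q k).
Proof.
move=> Ffin; elim: r => [|q r IHr]; first by exists fset0 => i _; rewrite big_nil.
by have [A FA] := fin_suppD (Ffin q) IHr; exists A => i /FA; rewrite big_cons.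
Qed.

Lemma fsum_exchange (I : Type) (r : seq I) (F : I -> T -> V) :
  (forall q, fin_supp (F q)) ->
  \sum_(k \in [set: T]) \sum_(q <- r) F q k
  = \sum_(q <- r) \sum_(k \in [set: T]) F q k.
Proof.
move=> Ffin; elim: r => [|q r IHr].
  by rewrite big_nil fsbig1 // => k _; rewrite big_nil.
rewrite big_cons -IHr -fsumD //; last exact: fin_supp_sum.
by apply: eq_fsbigr => k _; rewrite big_cons.
Qed.

Lemma fsum_morph (W : nmodType) (f : {additive V -> W}) F : fin_supp F ->
  f (\sum_(k \in [set: T]) F k) = \sum_(k \in [set: T]) f (F k).
Proof.
move=> [A FA]; rewrite (fsbigTE _ _ FA) raddf_sum; apply/esym/fsbigTE => i /FA ->.
exact: raddf0.
Qed.

End FiniteSupport.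

(** * Contour integrals as pairings of coefficients *)

Section Residues.
Variable C : numFieldType.
Implicit Types (g h : nat -> C) (P Q : {poly C}).

Lemma in_z_neg (V : nmodType) (g : nat -> V) (k : int) : k < 0 -> in_z g k = 0.
Proof. by case: k. Qed.

Lemma fin_supp_in_zM g h (a b : int) :
  fin_supp (fun k => in_z g (k + a) * in_z h (b - k)).
Proof.
apply: (@fin_supp_int _ _ (- a) b) => k kab.
  by rewrite in_z_neg ?mul0r //; lia.
by rewrite [X in _ * X]in_z_neg ?mulr0 //; lia.
Qed.

Lemma in_z_conv g h (n : int) :
  \sum_(k \in [set: int]) in_z g k * in_z h (n - k)
  = in_z (fun m => \sum_(i < m.+1) g i * h (m - i)%N) n.
Proof.
case: n => n.
  rewrite (fsbigE [seq Posz i | i <- iota 0 n.+1]).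
  - rewrite big_map [RHS]/= -(big_mkord xpredT (fun i => g i * h (n - i)%N)).
    rewrite [LHS]big_mkcond [in RHS]/index_iota subn0 [LHS]big_seq [RHS]big_seq.
    apply: eq_bigr => i; rewrite mem_iota => /andP[_ ilt].
    rewrite in_setT; congr (_ * _).
    by have -> : n%:Z - i%:Z = (n - i)%N by lia.
  - by rewrite map_inj_uniq ?iota_uniq // => i j [].
  - by [].
  - move=> i _ /mapP iA; case: i iA => i iA; last by rewrite mul0r.
    rewrite [X in _ * X]in_z_neg ?mulr0 //.
    by case: (ltnP i n.+1) => [ilt|]; [case: iA; exists i; rewrite ?mem_iota | lia].
rewrite fsbig1 // => k _; case: k => k; last by rewrite mul0r.
by rewrite [X in _ * X]in_z_neg ?mulr0 //; lia.
Qed.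

Lemma in_z_conv_shift g h (a b n : int) :
  \sum_(k \in [set: int]) in_z g (k + a) * in_z h (n - k + b)
  = in_z (fun m => \sum_(i < m.+1) g i * h (m - i)%N) (n + a + b).
Proof.
rewrite -in_z_conv [RHS](@reindex_fsbigT _ _ _ _ _ (fun k : int => k + a)); last first.
  by exists (fun k => k - a) => k; rewrite ?addrK ?subrK.
by apply: eq_fsbigr => k _; congr (_ * in_z h _); ring.
Qed.

(** With [u q = in_z g (n + q)] this is the coefficient of [z^n] in [P(z^-1) g(z)]. *)
Definition poly_pair P (u : nat -> C) : C := \sum_(i < size P) P`_i * u i.

Lemma poly_pairE n P u : (size P <= n)%N ->
  poly_pair P u = \sum_(i < n) P`_i * u i.
Proof.
move=> Pn; rewrite /poly_pair (big_ord_widen n (fun i => P`_i * u i)) //.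
rewrite big_mkcond; apply: eq_bigr => i _; case: ltnP => // Pi.
by rewrite nth_default ?mul0r.
Qed.

Lemma poly_pairM P Q u :
  poly_pair (P * Q) u
  = \sum_(q < size P) \sum_(r < size Q) P`_q * (Q`_r * u (q + r)%N).
Proof.
set n := (size P + size Q)%N.
rewrite (@poly_pairE n); last by rewrite (leq_trans (size_polyMleq _ _)) ?leq_pred.
under eq_bigr => i _ do rewrite coefM mulr_suml.
transitivity (\sum_(i < n) \sum_(q < n | (q <= i)%N) P`_q * Q`_(i - q) * u i).
  apply: eq_bigr => i _.
  by rewrite (big_ord_widen n (fun q => P`_q * Q`_(i - q) * u i)).
rewrite (exchange_big_dep xpredT) //=.
rewrite (big_ord_widen n
  (fun q => \sum_(r < size Q) P`_q * (Q`_r * u (q + r)%N))) ?leq_addr //.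
rewrite [RHS]big_mkcond; apply: eq_bigr => q _; case: ltnP => qP; last first.
  by apply: big1 => i _; rewrite nth_default ?mul0r.
rewrite -(big_mkord (fun i => (q <= i)%N) (fun i => P`_q * Q`_(i - q) * u i)).
rewrite (@big_cat_nat _ _ _ q) //=; last by rewrite ltnW ?ltn_ord.
rewrite big_nat_cond big1 ?add0r; last by move=> i ?; exfalso; lia.
rewrite -{1}[nat_of_ord q]add0n big_addn.
rewrite (@big_cat_nat _ _ _ (size Q)) //=; last first.
  by rewrite leq_subRL ?(ltnW (ltn_ord q)) // leq_add2r ltnW.
rewrite [X in _ + X]big_nat_cond [X in _ + X]big1 ?addr0; last first.
  by move=> i /andP[/andP[Qi _] _]; rewrite addnK [Q`_i]nth_default ?mulr0 ?mul0r.
rewrite -(big_mkord xpredT (fun r => P`_q * (Q`_r * u (q + r)%N))) big_mkcond.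
apply: eq_bigr => i _; rewrite leq_addl addnK -mulrA; congr (_ * (_ * u _)).
exact: addnC.
Qed.

(** The coefficient of [z^n] in [P(z^-1) e^{xi(x, z)} Q(z^-1) e^{xi(y, z)}]. For fixed powers of
    [z^-1] taken from [P] and [Q], the sum over [k] is a Cauchy product of exponentials, which
    [exp_xi_numD] merges into one. *)
Lemma vertex_residue P Q (x y : nat -> C) (n : int) :
  \sum_(k \in [set: int])
     poly_pair P (fun q => in_z (exp_xi_num x) (k + q%:Z)) *
     poly_pair Q (fun r => in_z (exp_xi_num y) (n - k + r%:Z))
  = poly_pair (P * Q)
      (fun s => in_z (exp_xi_num (fun j => x j + y j)) (n + s%:Z)).
Proof.
rewrite poly_pairM /poly_pair.
pose G (q r : nat) (k : int) := P`_q * (Q`_r *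
  (in_z (exp_xi_num x) (k + q%:Z) * in_z (exp_xi_num y) (n - k + r%:Z))).
have Gfin q r : fin_supp (G q r).
  have [A hA] := fin_supp_in_zM (exp_xi_num x) (exp_xi_num y) q (n + r%:Z).
  by exists A => i /hA; rewrite /G addrAC => ->; rewrite !mulr0.
transitivity (\sum_(k \in [set: int])
   \sum_(q < size P) \sum_(r < size Q) G q r k).
  apply: eq_fsbigr => k _; rewrite mulr_suml; apply: eq_bigr => q _.
  rewrite mulr_sumr; apply: eq_bigr => r _.
  by rewrite /G mulrACA !mulrA.
rewrite fsum_exchange => [|q]; last exact: fin_supp_sum.
apply: eq_bigr => q _; rewrite fsum_exchange //; apply: eq_bigr => r _.
rewrite -!mulr_fsumr in_z_conv_shift; congr (_ * (_ * _)).
rewrite -addrA PoszD /=; case: (n + _) => // m.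
exact: exp_xi_numD.
Qed.

Lemma res_zinv_z (k : int) P (h : nat -> C) :
  res (zpow k (fdmul (in_zinv (fun q => P`_q)) (in_z h)))
  = poly_pair P (fun s => in_z h (-1 - k + s%:Z)).
Proof.
rewrite /res /zpow /fdmul /in_zinv /poly_pair.
rewrite (fsbigE [seq - Posz i | i <- iota 0 (size P)]).
- rewrite big_map -(big_mkord xpredT (fun s => P`_s * in_z h (-1 - k + s%:Z))).
  rewrite [LHS]big_mkcond [in RHS]/index_iota subn0.
  by apply: eq_bigr => i _; rewrite in_setT !opprK.
- by rewrite map_inj_uniq ?iota_uniq // => i j; lia.
- by [].
move=> i _ /mapP iA; have [j ij] : exists j, i = - j by exists (- i); rewrite opprK.
rewrite {}ij in iA *; rewrite opprK; case: j iA => i0 iA; last by rewrite mul0r.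
rewrite /= nth_default ?mul0r // leqNgt; apply/negP => ilt.
by case: iA; exists i0; rewrite // mem_iota.
Qed.

(** The coefficient of [z^(-1-k)] in a series is that of [z^(1+k)] after [z] is replaced by [z^-1].
    The integrals over [C_r] thus take the same shape as those over [C_R]. *)
Lemma res_z_zinv (k : int) P (h : nat -> C) :
  res (zpow k (fdmul (in_z (fun q => P`_q)) (in_zinv h)))
  = poly_pair P (fun s => in_z h (1 + k + s%:Z)).
Proof.
rewrite /res /zpow /fdmul /in_zinv /poly_pair.
rewrite (fsbigE [seq Posz i | i <- iota 0 (size P)]).
- rewrite big_map -(big_mkord xpredT (fun s => P`_s * in_z h (1 + k + s%:Z))).
  rewrite [LHS]big_mkcond [in RHS]/index_iota subn0.
  by apply: eq_bigr => i _; rewrite in_setT; congr (_ * in_z h _); ring.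
- by rewrite map_inj_uniq ?iota_uniq // => i j [].
- by [].
move=> i _ /mapP iA; case: i iA => i iA; last by rewrite mul0r.
rewrite /= nth_default ?mul0r // leqNgt; apply/negP => ilt.
by case: iA; exists i; rewrite // mem_iota.
Qed.

End Residues.

(** * Polynomials in the times *)

Section Substitution.
Variables (C : numFieldType) (A : comNzRingType) (iota : {rmorphism C -> A}).
Variable x : bool -> nat -> A.

(** This is the function of monomials inside [tsubst], named so as to carry a multiplicative
    structure, from which [tsubst] inherits that of a ring morphism. *)
Definition tmon (m : {cmonom (bool * nat)%type}) : A :=
  \prod_(v <- finsupp (cmonom_val m)) x v.1 v.2 ^+ m v.

Lemma tmonE (d : {fset (bool * nat)%type}) (m : {cmonom (bool * nat)%type}) :
  (finsupp (cmonom_val m) `<=` d)%fset ->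
  tmon m = \prod_(v <- d) x v.1 v.2 ^+ m v.
Proof.
move=> le; rewrite /tmon; apply: (big_fset_incl _ le) => // v _.
by rewrite -cmE_eq0 => /eqP ->.
Qed.

Lemma tmon_mmorphism : mmorphism tmon.
Proof.
split=> [m1 m2|]; last by rewrite /tmon mdom1 big_seq_fset0.
rewrite (@tmonE (finsupp (cmonom_val m1) `|` finsupp (cmonom_val m2))%fset) ?mdomD //.
rewrite (@tmonE _ m1 (fsubsetUl _ (finsupp (cmonom_val m2)))).
rewrite (@tmonE _ m2 (fsubsetUr (finsupp (cmonom_val m1)) _)).
by rewrite -big_split; apply: eq_bigr => v _; rewrite cmM exprD.
Qed.

HB.instance Definition _ := isMultiplicative.Build _ _ tmon tmon_mmorphism.

Lemma tsubstD f g : tsubst iota x (f + g) = tsubst iota x f + tsubst iota x g.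
Proof. exact: (mmapD (f := iota) (h := tmon)). Qed.

Lemma tsubst0 : tsubst iota x 0 = 0.
Proof. exact: (mmap0 (f := iota) (h := tmon)). Qed.

Lemma tsubstM f g : tsubst iota x (f * g) = tsubst iota x f * tsubst iota x g.
Proof. exact: (rmorphM (mmap iota tmon)). Qed.

Lemma tsubstZ c f : tsubst iota x (c *: f) = iota c * tsubst iota x f.
Proof. exact: (mmapZ (f := iota) (h := tmon)). Qed.

Lemma tsubstC c : tsubst iota x c%:MP = iota c.
Proof. exact: (mmapC (f := iota) (h := tmon)). Qed.

Lemma tsubst_var a k : tsubst iota x (tvar C a k) = x a k.
Proof.
rewrite /tsubst /tvar (mmapU (f := iota)) /= (rmorph1 iota) mul1r.
by rewrite mdomU big_seq_fset1 cmUU expr1.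
Qed.

End Substitution.

Lemma malgUZ (K : choiceType) (A : nzRingType) (c x : A) (k : K) :
  << c * x *g k >> = c *: << x *g k >>.
Proof. by apply/malgP => k'; rewrite mcoeffZ !mcoeffU mulrnAr. Qed.

Lemma malg_additive_eq (K : choiceType) (A V : zmodType)
    (L1 L2 : {malg A[K]} -> V) :
  (forall g h, L1 (g + h) = L1 g + L1 h) ->
  (forall g h, L2 (g + h) = L2 g + L2 h) ->
  (forall c k, L1 << c *g k >> = L2 << c *g k >>) -> forall g, L1 g = L2 g.
Proof.
move=> L1D L2D LU g; rewrite (monalgE g).
have L10 : L1 0 = 0 by apply: (@addrI _ (L1 0)); rewrite -L1D !addr0.
have L20 : L2 0 = 0 by apply: (@addrI _ (L2 0)); rewrite -L2D !addr0.
apply: (big_ind (fun h => L1 h = L2 h)) => [|h h' e e'|k _]; rewrite ?LU //.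
  by rewrite L10 L20.
by rewrite L1D L2D e e'.
Qed.

Section Monomials.
Variables (I : choiceType) (m : cmonom I).

Lemma divcm_mulK u : divcm (mmul (ucm u) m) (ucm u) = m.
Proof. by apply/eqP/cmP => w; rewrite divcmE cmM addKn. Qed.

Lemma mul_divcmK u : m u != 0%N -> mmul (ucm u) (divcm m (ucm u)) = m.
Proof.
move=> mu; apply/eqP/cmP => w; rewrite cmM divcmE cmU.
by case: eqP => [<-|_]; [rewrite subnKC // lt0n | rewrite subn0].
Qed.

Lemma divcm_mulC u v : u != v ->
  divcm (mmul (ucm v) m) (ucm u) = mmul (ucm v) (divcm m (ucm u)).
Proof.
move=> uv; apply/eqP/cmP => w; rewrite cmM !divcmE cmM !cmU.
case: (eqVneq u w) => [<-|_]; last by rewrite !subn0.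
by rewrite eq_sym (negPf uv).
Qed.

Lemma divcmAC u v : divcm (divcm m u) v = divcm (divcm m v) u.
Proof. by apply/eqP/cmP => w; rewrite !divcmE subnAC. Qed.

End Monomials.

(** * Partial derivatives with respect to the times *)

Section Derivation.
Variable C : numFieldType.
Implicit Types f g : tpoly C.

Lemma tvarMU b l (c : C) (m : {cmonom (bool * nat)%type}) :
  tvar C b l * << c *g m >> = << c *g mmul (ucm (b, l)) m >>.
Proof.
by rewrite malgM_def fgmulUU mul1r.
Qed.

(** Induction on the degree of a monomial, one variable being factored out at each step. It reduces
    the identities about shifts and derivatives to constants, sums and multiplication by a
    variable. *)
Lemma tpoly_ind (P : tpoly C -> Prop) :
  (forall c, P c%:MP) -> (forall f g, P f -> P g -> P (f + g)) ->
  (forall a k f, P f -> P (tvar C a k * f)) -> forall f, P f.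
Proof.
move=> PC PD PX f.
have P0 : P 0 by rewrite -malgC0E; apply: PC.
have PU c m : P << c *g m >>.
  have [n] := ubnP (mdeg m); elim: n m => // n IHn m.
  have [->|m1] := eqVneq m mone; first by move=> _; apply: PC.
  have [v vm] : exists v, v \in finsupp (cmonom_val m).
    apply/fset0Pn; apply: contra m1 => /eqP m0.
    by rewrite -mdeg_eq0 mdegE m0 big_seq_fset0.
  have em : m = mmul (ucm v) (divcm m (ucm v)).
    apply/eqP/cmP => w; rewrite cmM divcmE cmU; case: eqP => [<-|_]; last by lia.
    by move: vm; rewrite -cmE_neq0; lia.
  rewrite {1}em mdegM mdegU add1n ltnS => /IHn Pm.
  have := PX v.1 v.2 _ Pm; by rewrite tvarMU -surjective_pairing -em.
by rewrite (monalgE f); apply: (big_ind P) => // m _; apply: PU.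
Qed.

Lemma tderivU a k (c : C) (m : {cmonom (bool * nat)%type}) :
  tderiv a k << c *g m >> = << c *+ m (a, k) *g divcm m (ucm (a, k)) >>.
Proof.
rewrite /tderiv msuppU; case: eqP => [->|_]; last first.
  by rewrite big_seq_fset1 mcoeffUU.
by rewrite big_seq_fset0 mul0rn monalgU0.
Qed.

Lemma tderivE a k (d : {fset {cmonom (bool * nat)%type}}) f :
  (msupp f `<=` d)%fset ->
  tderiv a k f = \sum_(m <- d) << f@_m *+ m (a, k) *g divcm m (ucm (a, k)) >>.
Proof.
move=> le; apply: (big_fset_incl _ le) => // m _ /mcoeff_outdom ->.
by rewrite mul0rn monalgU0.
Qed.

Lemma tderiv_linear a k : linear (tderiv a k : tpoly C -> tpoly C).
Proof.
move=> c f g.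
pose d := (msupp f `|` msupp g)%fset.
rewrite (@tderivE a k d f) ?fsubsetUl // (@tderivE a k d g) ?fsubsetUr //.
rewrite (@tderivE a k d); last first.
  apply: fsubset_trans (msuppD_le _ _) _; apply: fsetUSS => //.
  exact: msuppZ_le.
rewrite scaler_sumr -big_split; apply: eq_bigr => m _.
have -> : (c *: f + g)@_m = c * f@_m + g@_m by rewrite mcoeffD mcoeffZ.
rewrite mulrnDl monalgUD -mulrnAr; congr (_ + _).
exact: malgUZ.
Qed.

HB.instance Definition _ a k :=
  GRing.isLinear.Build C (tpoly C) (tpoly C) *:%R (tderiv a k)
    (@tderiv_linear a k).

Lemma tderivC a k c : tderiv a k c%:MP = 0 :> tpoly C.
Proof. by rewrite tderivU cm1 mulr0n monalgU0. Qed.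

Lemma tderivX a k b l f :
  tderiv a k (tvar C b l * f)
  = (if (a, k) == (b, l) then f else 0) + tvar C b l * tderiv a k f.
Proof.
pose L1 g := tderiv a k (tvar C b l * g).
pose L2 g := (if (a, k) == (b, l) then g else 0) + tvar C b l * tderiv a k g.
apply: (@malg_additive_eq _ _ _ L1 L2) => [g h|g h|c m].
- by rewrite /L1 (mulrDr (tvar C b l) g h); apply: (linearD (tderiv a k)).
- rewrite /L2 (linearD (tderiv a k)) (mulrDr (tvar C b l)).
  by rewrite [RHS]addrACA; congr (_ + _); case: ifP => _ //; rewrite addr0.
have -> : L1 << c *g m >> = << c *+ (mmul (ucm (b, l)) m) (a, k)
                          *g divcm (mmul (ucm (b, l)) m) (ucm (a, k)) >>.
  by rewrite /L1 tvarMU tderivU.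
have -> : L2 << c *g m >> = (if (a, k) == (b, l) then << c *g m >> else 0)
    + << c *+ m (a, k) *g mmul (ucm (b, l)) (divcm m (ucm (a, k))) >>.
  by rewrite /L2; congr (_ + _); rewrite tderivU tvarMU.
rewrite cmM cmU [(b, l) == _]eq_sym.
case: eqP => [->|/eqP ne]; last first.
  by rewrite add0r add0n divcm_mulC.
rewrite divcm_mulK (mulrnDr c 1%N (m (b, l))) (monalgUD m) (mulr1n c).
(* [divcm] truncates at exponent 0, so dividing by the variable and multiplying back restores [m]
   only if the variable occurs in [m]; otherwise the coefficient of that term is 0. *)
have [m0|m0] := eqVneq (m (b, l)) 0%N; last by rewrite mul_divcmK.
by rewrite m0 mulr0n !monalgU0.
Qed.

Lemma tderiv_comm a k b l f :
  tderiv a k (tderiv b l f) = tderiv b l (tderiv a k f).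
Proof.
have tderiv2U a' k' b' l' (c : C) (m : {cmonom (bool * nat)%type}) :
    tderiv a' k' (tderiv b' l' << c *g m >>) = << c *+ m (b', l')
      *+ (divcm m (ucm (b', l'))) (a', k')
      *g divcm (divcm m (ucm (b', l'))) (ucm (a', k')) >>.
  by rewrite (tderivU b' l' c m) tderivU.
apply: (@malg_additive_eq _ _ _ (tderiv a k \o tderiv b l)
   (tderiv b l \o tderiv a k)) => [g h|g h|c m].
- exact: (linearD (tderiv a k \o tderiv b l)).
- exact: (linearD (tderiv b l \o tderiv a k)).
apply: etrans (tderiv2U _ _ _ _ _ _) _; apply: etrans (esym (tderiv2U _ _ _ _ _ _)).
rewrite divcmAC -!mulrnA; congr << _ *+ _ *g _ >>.
by rewrite !divcmE !cmU; case: (eqVneq (b, l) (a, k)) => [->|_]; lia.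
Qed.

End Derivation.

(** * Taylor's formula *)

Section TaylorStep.
Variables (A : comNzRingType) (e : A) (n : nat).
Implicit Types (S : {poly A}) (G : nat -> {poly A}).

Lemma taylor_add S1 S2 G1 G2 G i :
  S1^`()`_i = (e%:P * \sum_(j < n) 'X^j * G1 j)`_i ->
  S2^`()`_i = (e%:P * \sum_(j < n) 'X^j * G2 j)`_i ->
  (forall j, G j = G1 j + G2 j) ->
  (S1 + S2)^`()`_i = (e%:P * \sum_(j < n) 'X^j * G j)`_i.
Proof.
move=> h1 h2 GE; rewrite derivD coefD h1 h2 -coefD -mulrDr -big_split /=.
by under [in RHS]eq_bigr => j _ do rewrite GE mulrDr.
Qed.

(** [S1] stands for a shifted variable of index [l], and [b] tells whether it belongs to the shifted
    component. If [l >= n], the sum has no term [j = l], but [e z^l S2] then contributes nothing in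
    degree [i < n]. *)
Lemma taylor_mul (b : bool) (l : nat) S1 S2 G2 G :
  S1^`() = (if b then e%:P * 'X^l else 0) ->
  (forall j, G j = (if b && (j == l) then S2 else 0) + S1 * G2 j) ->
  (forall i, (i < n)%N -> S2^`()`_i = (e%:P * \sum_(j < n) 'X^j * G2 j)`_i) ->
  forall i, (i < n)%N ->
    (S1 * S2)^`()`_i = (e%:P * \sum_(j < n) 'X^j * G j)`_i.
Proof.
move=> h1 GE h2 i ilt; set D := \sum_(j < n) _ in h2.
have -> : \sum_(j < n) 'X^j * G j
    = (if b && (l < n)%N then 'X^l * S2 else 0) + S1 * D.
  have -> : (if b && (l < n)%N then 'X^l * S2 else 0)
    = \sum_(j < n) (if b && (nat_of_ord j == l) then 'X^j * S2 else 0).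
    rewrite -big_mkcond /=; case: b {h1 GE} => /=; last by rewrite big_pred0.
    case: ltnP => ln; first by rewrite (big_pred1 (Ordinal ln)).
    by rewrite big1 // => j /eqP jl; have := ltn_ord j; rewrite jl ltnNge ln.
  rewrite /D mulr_sumr -big_split; apply: eq_bigr => j _ /=.
  by rewrite GE mulrDr mulrCA; case: ifP => _; rewrite ?mulr0.
rewrite mulrDr coefD derivM coefD; congr (_ + _); last first.
  by rewrite mulrC (eq_coefM_low _ h2) // mulrC mulrCA.
rewrite {}h1; case: b {GE}; rewrite ?mulr0 ?mul0r //=.
case: ltnP => ln; first by rewrite mulrA.
by rewrite mulr0 coef0 -mulrA mulrCA coefXnM (leq_trans ilt ln).
Qed.

Lemma deriv_scaleXnS (c : A) l :
  (c *: 'X^(l.+1))^`() = (c *+ l.+1)%:P * 'X^l.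
Proof. by rewrite derivZ derivXn mul_polyC /= -scalerMnr scalerMnl. Qed.

End TaylorStep.

Section ScaledOperators.
Variables (A : comNzRingType) (V : lmodType A).

Lemma scale_linear (D : {linear V -> V}) (c : A) : linear (fun g => c *: D g).
Proof. by move=> b u v; rewrite linearP scalerDr !scalerA mulrC. Qed.

Lemma scale_comm (D D' : {linear V -> V}) (c c' : A) (v : V) :
  D (D' v) = D' (D v) -> c *: D (c' *: D' v) = c' *: D' (c *: D v).
Proof. by move=> DD; rewrite !linearZ /= DD !scalerA mulrC. Qed.

End ScaledOperators.

Section Taylor.
Variable C : numFieldType.
Implicit Types f g : tpoly C.

Definition cstC : {rmorphism C -> {poly tpoly C}} :=
  [the {rmorphism C -> {poly tpoly C}} of polyC \o (malgC : C -> tpoly C)].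

(* f(t + e [X]_a), with coefficients in C[t] *)
Definition tshift_gen (a : bool) (e : C) : tpoly C -> {poly tpoly C} :=
  tsubst cstC
    (fun b k => (tvar C b k)%:P +
       (if b == a then ((e / k.+1%:R)%:MP : tpoly C) *: 'X^(k.+1) else 0)).

Lemma tshift_gen_var a e b l : tshift_gen a e (tvar C b l) = (tvar C b l)%:P +
  (if b == a then ((e / l.+1%:R)%:MP : tpoly C) *: 'X^(l.+1) else 0).
Proof. exact: (tsubst_var cstC). Qed.

Lemma tshift_genD a e f g :
  tshift_gen a e (f + g) = tshift_gen a e f + tshift_gen a e g.
Proof. exact: (tsubstD cstC). Qed.

Lemma tshift_genM a e f g :
  tshift_gen a e (f * g) = tshift_gen a e f * tshift_gen a e g.
Proof. exact: (tsubstM cstC). Qed.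

Lemma tshift_genC a e c : tshift_gen a e c%:MP = (c%:MP)%:P.
Proof. exact: (tsubstC cstC). Qed.

Lemma tshift_genZ a e c f :
  tshift_gen a e (c *: f) = (c%:MP)%:P * tshift_gen a e f.
Proof. exact: (tsubstZ cstC). Qed.

Lemma coef_cstM c (S : {poly tpoly C}) i : ((c%:MP)%:P * S)`_i = c *: S`_i.
Proof. by rewrite mul_polyC coefZ mul_malgC. Qed.

Lemma coef_tshift_genZ a e c f i :
  (tshift_gen a e (c *: f))`_i = c *: (tshift_gen a e f)`_i.
Proof. by rewrite tshift_genZ; apply: coef_cstM. Qed.

(** The chain rule: the variable of index [j] is shifted by [e z^(j+1) / (j+1)], whose derivative is
    [e z^j]. Terms with [j >= n] do not reach degree [i]. *)
Lemma tshift_gen_deriv a e f n i : (i < n)%N ->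
  ((tshift_gen a e f)^`())`_i
  = ((e%:MP)%:P * \sum_(j < n) 'X^j * tshift_gen a e (tderiv a j f))`_i.
Proof.
elim/tpoly_ind: f i => [c|f g IHf IHg|b l f IHf] i ilt.
- rewrite tshift_genC derivC coef0 big1 ?mulr0 ?coef0 // => j _.
  by rewrite tderivC -malgC0E tshift_genC malgC0E polyC0 mulr0.
- rewrite tshift_genD; apply: (taylor_add (G := fun j => tshift_gen a e (tderiv a j (f + g)))
    (IHf i ilt) (IHg i ilt)) => j.
  by rewrite (linearD (tderiv a j)) /=; apply: tshift_genD.
rewrite tshift_genM; apply: (taylor_mul (b := b == a) (l := l)
  (G := fun j => tshift_gen a e (tderiv a j (tvar C b l * f))) _ _ IHf ilt).
  rewrite tshift_gen_var derivD derivC add0r; case: ifP => _; last exact: derivC.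
  have le : e / l.+1%:R *+ l.+1 = e by rewrite -mulr_natr divfK // pnatr_eq0.
  by rewrite deriv_scaleXnS -monalgUMn le.
move=> j; rewrite tderivX tshift_genD; apply: f_equal2; last exact: tshift_genM.
rewrite xpair_eqE eq_sym; case: ifP => // _.
by rewrite -malgC0E tshift_genC malgC0E polyC0.
Qed.

(* The Taylor formula exp (e sum_j z^(j+1) d/dt_(j+1) / (j+1)) f = f(t + e [z]_a). *)
Lemma exp_xi_tderiv a e f k :
  exp_xi (fun j (g : tpoly C) => (e / j.+1%:R) *: tderiv a j g) f k
  = (tshift_gen a e f)`_k.
Proof.
(* [f] is generalised because the recursion for [f] at [k+1] calls the lower coefficients for its
   derivatives [tderiv a j f]. *)
elim/ltn_ind: k f => -[|k] IHk f.
  rewrite exp_xi0; elim/tpoly_ind: f => [c|f g IHf IHg|b l f IHf].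
  - by rewrite tshift_genC coefC.
  - rewrite tshift_genD coefD; exact: (f_equal2 +%R IHf IHg).
  rewrite tshift_genM coef0M; apply: (f_equal2 *%R _ IHf).
  rewrite tshift_gen_var coefD coefC /=.
  by case: ifP => _; rewrite ?coefZ ?coefXn ?coef0 /= ?mulr0 addr0.
have kn : (k.+1%:R : C) != 0 by rewrite pnatr_eq0.
apply: (scalerI kn).
rewrite exp_xi_rec_r; last 2 first.
- by move=> j; apply: (scale_linear (tderiv a j)).
- by move=> i j v; 
  exact: (@scale_comm C _ (tderiv a i) (tderiv a j) (e / i.+1%:R) (e / j.+1%:R)
            v (tderiv_comm a i a j v)).
apply: etrans (_ : (tshift_gen a e f)^`()`_k = _); last first.
  by rewrite coef_deriv scaler_nat.
apply/esym; rewrite (tshift_gen_deriv a e f (ltnSn k)) coef_cstM.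
rewrite coef_sum scaler_sumr; apply: eq_bigr => j _.
rewrite coefXnM subSS ltnNge -ltnS ltn_ord /=.
have jk : (k - j < k.+1)%N by rewrite ltnS leq_subr.
have -> : exp_xi (fun j (g : tpoly C) => (e / j.+1%:R) *: tderiv a j g)
    ((e / j.+1%:R) *: tderiv a j f) (k - j)%N
  = (e / j.+1%:R) *: (tshift_gen a e (tderiv a j f))`_(k - j).
  apply: etrans (IHk _ jk _) _.
  exact: coef_tshift_genZ.
by rewrite scalerA mulrCA divff ?mulr1 // pnatr_eq0.
Qed.

End Taylor.

Section Evaluation.
Variables (C : numFieldType) (t : bool -> nat -> C).

HB.instance Definition _ :=
  GRing.RMorphism.copy (teval t) (mmap idfun (tmon t)).

Lemma teval_linear : linear (teval t : tpoly C -> C^o).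
Proof.
by move=> c f g; rewrite /teval tsubstD tsubstZ.
Qed.

Lemma tevalZ c f : teval t (c *: f) = c * teval t f.
Proof. exact: tsubstZ. Qed.

Lemma coef_tshift a e f q :
  (tshift a e t f)`_q = teval t (tshift_gen a e f)`_q.
Proof.
suff -> : tshift a e t f = map_poly (teval t) (tshift_gen a e f) by rewrite coef_map.
elim/tpoly_ind: f => [c|f g IHf IHg|b k f IHf].
- by rewrite tshift_genC map_polyC /= /teval /tshift !tsubstC.
- rewrite tshift_genD (rmorphD (map_poly (teval t))) [LHS]tsubstD.
  exact: (f_equal2 +%R IHf IHg).
rewrite tshift_genM (rmorphM (map_poly (teval t))) [LHS]tsubstM.
apply: (f_equal2 *%R _ IHf).
rewrite tsubst_var tshift_gen_var (rmorphD (map_poly (teval t))).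
rewrite /= map_polyC /= [teval t _]tsubst_var.
apply: f_equal2 => //; case: ifP => _; last by rewrite rmorph0.
rewrite map_polyZ map_polyXn /=; congr (_ *: _); exact: (esym (tsubstC idfun t _)).
Qed.

Lemma exp_xi_zero (V : lmodType C) (x : nat -> V -> V) k :
  (forall j, x j 0 = 0) -> exp_xi x 0 k = 0.
Proof.
move=> x0; apply/esym; apply: (@exp_xi_natural C V V (fun=> 0) x x 0 k) => //.
by move=> c u v; rewrite scaler0 addr0.
Qed.

(** By Taylor's formula the lowering exponential gives a polynomial in [z^-1], whose size bounds the
    sum over [q]. Evaluation at [t] then turns multiplication by the variables in the raising
    exponential into multiplication by numbers. *)
Lemma teval_vertex_exp lam a f n (e := (sgz_of lam)%:~R : C) :
  teval t (vertex_exp lam a f n)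
  = poly_pair (tshift a (- e) t f)
      (fun q => in_z (exp_xi_num (fun j => e * t a j)) (n + q%:Z)).
Proof.
pose S := tshift_gen a (- e) f.
rewrite (@poly_pairE _ (size S)); last first.
  by apply/leq_sizeP => q qS; rewrite coef_tshift nth_default // rmorph0.
rewrite /vertex_exp (fsbigE (iota 0 (size S))) ?iota_uniq //; last first.
  move=> q _; rewrite mem_iota /= -leqNgt => qS.
  rewrite exp_xi_tderiv nth_default //; case: (n + _) => //= k.
  by apply: exp_xi_zero => j; rewrite mulr0.
rewrite -(big_mkord xpredT (fun q => (tshift a (- e) t f)`_q *
   in_z (exp_xi_num (fun j => e * t a j)) (n + q%:Z))).
rewrite big_mkcond [in RHS]/index_iota subn0 rmorph_sum /=.
apply: eq_bigr => q _; rewrite in_setT exp_xi_tderiv coef_tshift.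
case: (n + _) => k /=; last by rewrite rmorph0 mulr0.
rewrite -exp_xi_numE.
apply: (@exp_xi_natural C (tpoly C) C^o) => [|j g]; first exact: teval_linear.
by rewrite rmorphM /= tevalZ /teval tsubst_var.
Qed.

End Evaluation.

(** * Linear functionals on the fermionic Fock space *)

Section Pairing.
Variable C : numFieldType.
Implicit Types (u v : fock C) (w : fock2 C) (phi chi : fock C -> C).

(** [tens_op] applies its operators to basis monomials only. This property of [phi \o A] and
    [chi \o B] is what recovers [phi (A u) * chi (B v)] from those values. *)
Definition basis_determined phi :=
  forall u, phi u = \sum_(S <- msupp u) u@_S * phi << S >>.

Definition pairing phi chi : fock2 C -> C :=
  mmap idfun (fun k : {fset mode} * {fset mode} => phi << k.1 >> * chi << k.2 >>).

HB.instance Definition _ phi chi := GRing.Additive.copy (pairing phi chi)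
  (mmap idfun (fun k : {fset mode} * {fset mode} => phi << k.1 >> * chi << k.2 >>)).

Lemma pairingZ phi chi c w : pairing phi chi (c *: w) = c * pairing phi chi w.
Proof.
rewrite /pairing (mmapEw (d := msupp w)) ?msuppZ_le // mmapE mulr_sumr.
by apply: eq_bigr => k _; rewrite mcoeffZ /= -mulrA.
Qed.

Lemma pairing_tens phi chi u v : basis_determined phi -> basis_determined chi ->
  pairing phi chi (tens u v) = phi u * chi v.
Proof.
move=> phiE chiE; rewrite (phiE u) (chiE v) mulr_suml /tens raddf_sum.
apply: eq_bigr => S _; rewrite raddf_sum mulr_sumr; apply: eq_bigr => T _.
by rewrite /= /pairing mmapU /= mulrACA.
Qed.

Lemma pairing_tens_op phi chi (A B : fock C -> fock C) u v :
  basis_determined phi -> basis_determined chi ->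
  basis_determined (phi \o A) -> basis_determined (chi \o B) ->
  pairing phi chi (tens_op A B (tens u v)) = phi (A u) * chi (B v).
Proof.
move=> phiE chiE phiAE chiBE; rewrite -(pairing_tens u v phiAE chiBE).
rewrite {1}/tens_op raddf_sum; apply: eq_bigr => k _ /=.
by rewrite pairingZ pairing_tens.
Qed.

Lemma psiU lam a S : psi lam a << S >> = psi_basis C lam a S.
Proof. by rewrite /psi msuppU oner_eq0 big_seq_fset1 mcoeffUU scale1r. Qed.

Lemma psi_determined lam a (phi : {scalar fock C}) :
  basis_determined (phi \o psi lam a).
Proof.
move=> u; rewrite /= /psi linear_sum; apply: eq_bigr => S _.
by rewrite linearZ -psiU.
Qed.

Lemma scalar_determined (phi : {scalar fock C}) : basis_determined phi.
Proof.
move=> u; rewrite {1}(monalgE u) linear_sum; apply: eq_bigr => S _.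
by rewrite -[u@_S]mulr1 malgUZ linearZ mulr1.
Qed.

Lemma tens0l v : tens 0 v = 0 :> fock2 C.
Proof. by rewrite /tens msupp0 big_seq_fset0. Qed.

Lemma tens0r u : tens u 0 = 0 :> fock2 C.
Proof. by rewrite /tens big1 // => S _; rewrite msupp0 big_seq_fset0. Qed.

Lemma psi_basis_large lam (S : {fset mode}) :
  exists b : int, forall a, b < a -> psi_basis C lam a S = 0.
Proof.
(* A positive mode acts nontrivially only by removing a factor of [S]; the sum of the indices
   occurring in [S] is a crude bound for each of them. *)
exists (\sum_(x <- S) x.2)%N%:Z => -[a|//] ba; rewrite /psi_basis ifN //.
apply/negP => xS; move: ba; rewrite ltz_nat ltnNge => /negP; apply.
by rewrite (big_fsetD1 _ xS) leq_addr.
Qed.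

Lemma fin_supp_Omega (s : int) w :
  fin_supp (fun a => tens_op (psi true a) (psi false (s - 1 - a)) w).
Proof.
apply: fin_supp_sum => k.
have [b1 hb1] := psi_basis_large true k.1.
have [b2 hb2] := psi_basis_large false k.2.
apply: (@fin_supp_int _ _ (s - 1 - b2) b1) => a ha; rewrite !psiU.
  by rewrite hb2 ?tens0r ?scaler0 //; lia.
by rewrite hb1 // tens0l scaler0.
Qed.

Lemma pairing_Omega (phi chi : {scalar fock C}) s u v :
  pairing phi chi (Omega s (tens u v))
  = \sum_(a \in [set: int]) phi (psi true a u) * chi (psi false (s - 1 - a) v).
Proof.
rewrite /Omega (fsum_morph (pairing phi chi)); last exact: fin_supp_Omega.
apply: eq_fsbigr => a _.
by apply: pairing_tens_op; [exact: scalar_determined | exact: scalar_determined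
  | exact: psi_determined | exact: psi_determined].
Qed.

Lemma fin_supp_pairing (phi chi : {scalar fock C}) s u v :
  fin_supp (fun a => phi (psi true a u) * chi (psi false (s - 1 - a) v)).
Proof.
have [A hA] := fin_supp_Omega s (tens u v); exists A => a /hA h.
rewrite -(pairing_tens_op (A := psi true a) (B := psi false (s - 1 - a))).
- by rewrite h raddf0.
- exact: scalar_determined.
- exact: scalar_determined.
- exact: psi_determined.
exact: psi_determined.
Qed.

End Pairing.

(** * Splitting the modes into two components *)

Section Relabelling.
Variables M N : nat.
Hypotheses (M0 : (0 < M)%N) (N0 : (0 < N)%N).

(** Each block of [M + N] consecutive integers gives its first [M] elements to component 1 and the
    other [N] to component 2, so the remainder modulo [M + N] decides the component. *)
Lemma relabel_bij : bijective (fun p : bool * int => relabel M N p.1 p.2).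
Proof.
pose g (a : int) : bool * int :=
  if ((a %% (M + N)%N)%Z < M)
  then (false, M%:Z * (a %/ (M + N)%N)%Z + (a %% (M + N)%N)%Z)
  else (true, N%:Z * (a %/ (M + N)%N)%Z + ((a %% (M + N)%N)%Z - M%:Z)).
have dm (d : nat) (q r : int) : 0 <= r -> r < d%:Z ->
    (((d%:Z * q + r) %/ d)%Z = q) * (((d%:Z * q + r) %% d)%Z = r).
  move=> r0 rd; have d0 : d%:Z != 0 by lia.
  by rewrite mulrC divzMDl // modzMDl divz_small ?modz_small ?addr0 ?r0.
have MZ0 : M%:Z != 0 by lia.
have NZ0 : N%:Z != 0 by lia.
have MN0 : (M + N)%N%:Z != 0 by lia.
exists g => [[[] b]|a]; rewrite /g /relabel /=.
- have := divz_eq b N; have := modz_ge0 b NZ0; have := @ltz_pmod b N.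
  move: (b %/ N)%Z (b %% N)%Z => q r rN r0 bE; have {}rN : r < N by apply: rN; lia.
  rewrite !dm; try lia.
  by rewrite ifF; [congr pair; rewrite bE; ring | lia].
- have := divz_eq b M; have := modz_ge0 b MZ0; have := @ltz_pmod b M.
  move: (b %/ M)%Z (b %% M)%Z => q r rM r0 bE; have {}rM : r < M by apply: rM; lia.
  rewrite !dm; try lia.
  by rewrite rM; congr pair; rewrite bE; ring.
have := divz_eq a (M + N)%N; have := modz_ge0 a MN0; have := @ltz_pmod a (M + N)%N.
move: (a %/ (M + N)%N)%Z (a %% (M + N)%N)%Z => q r rMN r0 aE.
have {}rMN : r < (M + N)%N%:Z by apply: rMN; lia.
by case: (ltP r M) => rM /=; rewrite !dm; lia.
Qed.

Definition period (c : bool) : int := if c then N else M.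

(** Moving by one block of [M + N] moves component 1 by [M] and component 2 by [N]: the origin of
    the powers [z^M] and [z^-N] in the first identity. *)
Lemma relabel_period c b :
  relabel M N c b + (M + N)%N%:Z = relabel M N c (b + period c).
Proof.
have MZ0 : M%:Z != 0 by lia.
have NZ0 : N%:Z != 0 by lia.
by case: c; rewrite /relabel /period modzDr divzDr ?dvdzz // divzz ?MZ0 ?NZ0 /=; ring.
Qed.

Lemma fsum_bool_int (V : nmodType) (F : bool * int -> V) : fin_supp F ->
  \sum_(p \in [set: bool * int]) F p
  = \sum_(b \in [set: int]) F (false, b) + \sum_(b \in [set: int]) F (true, b).
Proof.
move=> [A FA]; pose B := [fset p.2 | p in A]%fset.
have FB c b : b \notin B -> F (c, b) = 0.
  move=> bB; apply: FA; apply: contra bB => cA; apply/imfsetP.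
  by exists (c, b).
rewrite (fsbigE [seq (c, b) | c <- [:: false; true], b <- B]).
- rewrite (fsbigTE _ _ (FB false)) (fsbigTE _ _ (FB true)).
  rewrite big_mkcond big_allpairs !big_cons big_nil /= addr0.
  by congr (_ + _); apply: eq_bigr => b _; rewrite in_setT.
- apply: allpairs_uniq => //; by move=> [? ?] [? ?].
- by [].
move=> [c b] _ bB; apply: FB; apply: contra bB => bB; apply/allpairsP.
by exists (c, b); split=> //; case: (c).
Qed.

Lemma pairing_Omega_comp (C : numFieldType) (phi chi : {scalar fock C})
    (s : int) (sc : bool -> int) u v :
  (forall c b, relabel M N c b + s = relabel M N c (b + sc c)) ->
  pairing phi chi (Omega s (tens u v))
  = \sum_(b \in [set: int]) phi (psi_comp M N false true b u)
       * chi (psi_comp M N false false (-1 - b + sc false) v)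
  + \sum_(b \in [set: int]) phi (psi_comp M N true true b u)
       * chi (psi_comp M N true false (-1 - b + sc true) v).
Proof.
move=> hsc; rewrite pairing_Omega.
(* [h (c, b)] is the original number of the mode [b] of [psi^{+(c)}]: [relabel] conjugated by
   [a |-> -1 - a], which encodes the change of sign of a half-integer. *)
pose h (p : bool * int) := - 1 - relabel M N p.1 (- 1 - p.2).
have hbij : bijective h.
  have [g gK Kg] := relabel_bij.
  exists (fun a => ((g (- 1 - a)).1, - 1 - (g (- 1 - a)).2)) => [[c b]|a].
    rewrite /h; have -> : - 1 - (- 1 - relabel M N (c, b).1 (- 1 - (c, b).2))
       = relabel M N (c, - 1 - b).1 (c, - 1 - b).2 by rewrite /=; ring.
    by rewrite gK /=; congr pair; ring.
  rewrite /h /=; have := Kg (- 1 - a); case: (g _) => c b /= gE.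
  have -> : -1 - (- 1 - b) = b by ring.
  by rewrite gE; ring.
have hF := fin_supp_reindex hbij (fin_supp_pairing phi chi s u v).
apply: etrans (reindex_fsbigT _ _ hbij) _.
apply: etrans (fsum_bool_int hF) _.
have key c b : phi (psi true (h (c, b)) u) * chi (psi false (s - 1 - h (c, b)) v)
    = phi (psi_comp M N c true b u) * chi (psi_comp M N c false (- 1 - b + sc c) v).
  have -> : s - 1 - h (c, b) = relabel M N c (- 1 - b + sc c).
    by rewrite -hsc /h [(c, b).1]/= [(c, b).2]/=; ring.
  by [].
by apply: f_equal2; apply: eq_fsbigr => b _; apply: key.
Qed.

End Relabelling.

(** * The bilinear identities *)

Section Vertex.
Variable C : numFieldType.

Lemma tshiftZ a (e : C) t c f : tshift a e t (c *: f) = c%:P * tshift a e t f.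
Proof. exact: tsubstZ. Qed.

Lemma poly_pair0 (u : nat -> C) : poly_pair 0 u = 0.
Proof. by rewrite /poly_pair size_poly0 big_ord0. Qed.

Lemma poly_pairZ (c : C) P u : poly_pair (c%:P * P) u = c * poly_pair P u.
Proof.
rewrite (@poly_pairE _ (size P)); last by rewrite mul_polyC size_scale_leq.
by rewrite mulr_sumr; apply: eq_bigr => i _; rewrite mul_polyC coefZ mulrA.
Qed.

Lemma QshiftK a e l : Qshift a (- e) (Qshift a e l) = l.
Proof. by case: a l => -[l1 l2]; rewrite /Qshift /= addrK. Qed.

Lemma coef_vertex t lam a n (b : boson C) l
    (l0 := Qshift a (- sgz_of lam) l) (e := (sgz_of lam)%:~R : C) :
  teval t (vertex lam a n b)@_l
  = Qsign C a l0 * poly_pair (tshift a (- e) t b@_l0)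
      (fun q => in_z (exp_xi_num (fun j => e * t a j))
                  (n - sgz_of lam * Qdeg a l0 + q%:Z)).
Proof.
have l0K l1 : (Qshift a (sgz_of lam) l1 == l) = (l1 == l0).
  apply/eqP/eqP => [e1|->]; first by rewrite /l0 -e1 QshiftK.
  by rewrite /l0 -{1}[sgz_of lam]opprK QshiftK.
rewrite /vertex raddf_sum /= raddf_sum.
have E l1 : teval t (<< Qsign C a l1 *: zpow (sgz_of lam * Qdeg a l1)
      (vertex_exp lam a b@_l1) n *g Qshift a (sgz_of lam) l1 >> : boson C)@_l
  = if l1 == l0 then Qsign C a l0 * poly_pair (tshift a (- e) t b@_l0)
      (fun q => in_z (exp_xi_num (fun j => e * t a j))
                  (n - sgz_of lam * Qdeg a l0 + q%:Z)) else 0.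
  rewrite mcoeffU l0K; case: eqP => [->|_]; last by rewrite mulr0n raddf0.
  by rewrite mulr1n tevalZ teval_vertex_exp.
rewrite (eq_bigr _ (fun l1 _ => E l1)).
case: (boolP (l0 \in msupp b)) => lb.
  rewrite (big_fsetD1 l0) //= eqxx big_seq big1 ?addr0 // => l1.
  by rewrite !inE => /andP[/negPf->].
rewrite big_seq big1; last first.
  by move=> l1 l1b; case: eqP => // l1E; move: lb; rewrite -l1E l1b.
rewrite mcoeff_outdom // /tshift tsubst0 poly_pair0 mulr0 //.
Qed.

End Vertex.

Section Bilinear.
Variables (C : numFieldType) (M N : nat).
Hypotheses (M0 : (0 < M)%N) (N0 : (0 < N)%N).
Variables (sigma : fock C -> boson C).
Hypothesis hsigma : bosonization M N sigma.

Definition boson_coef (l : int * int) (t : bool -> nat -> C) (u : fock C) : C :=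
  teval t (sigma u)@_l.

Lemma boson_coef_scalar l t : scalar (boson_coef l t).
Proof.
case: hsigma => sigmaP _ _ _ x u v.
by rewrite /boson_coef sigmaP mcoeffD mcoeffZ rmorphD rmorphM /= [teval t _%:MP]tsubstC.
Qed.

HB.instance Definition _ l t :=
  GRing.isLinear.Build C (fock C) C *%R (boson_coef l t) (@boson_coef_scalar l t).

(** The vertex operator for [+] yields [e^{xi(t', z)} f(t' - [z^-1])] and the one for [-] yields
    [e^{-xi(t'', z)} g(t'' + [z^-1])]; summing over modes extracts one coefficient of their product.
    The scalars [x] and [y] are there to receive the signs of the expansions. *)
Lemma vertex_pairing c (s : int) u v l' l'' t' t'' (x y : C) f g
    (l0' := Qshift c (- 1) l') (l0'' := Qshift c 1 l'') :
  (sigma u)@_l0' = x *: f -> (sigma v)@_l0'' = y *: g ->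
  \sum_(b \in [set: int]) boson_coef l' t' (psi_comp M N c true b u)
     * boson_coef l'' t'' (psi_comp M N c false (- 1 - b + s) v)
  = Qsign C c l0' * Qsign C c l0'' * (x * y) *
    poly_pair (tshift c (- 1) t' f * tshift c 1 t'' g)
      (fun q => in_z (exp_xi_num (fun j => t' c j - t'' c j))
         (- 1 - (Qdeg c l0' - Qdeg c l0'' + s) + q%:Z)).
Proof.
move=> fE gE; case: (hsigma) => _ _ _ sigma_psi.
pose P := tshift c (- 1) t' f; pose Q := tshift c 1 t'' g.
pose F (k : int) := poly_pair P (fun q => in_z (exp_xi_num (t' c)) (k + q%:Z)).
pose G (k : int) := poly_pair Q
  (fun q => in_z (exp_xi_num (fun j => - t'' c j)) (k + q%:Z)).
have FE b : boson_coef l' t' (psi_comp M N c true b u)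
    = Qsign C c l0' * (x * F (- 1 - b - Qdeg c l0')).
  rewrite /boson_coef sigma_psi coef_vertex /= fE tshiftZ poly_pairZ mul1r.
  have -> : (fun j => 1%:~R * t' c j) = t' c by apply/funext => j; rewrite mul1r.
  by [].
have GE b : boson_coef l'' t'' (psi_comp M N c false b v)
    = Qsign C c l0'' * (y * G (- 1 - b + Qdeg c l0'')).
  rewrite /boson_coef sigma_psi coef_vertex /= opprK gE tshiftZ poly_pairZ.
  rewrite mulN1r !opprK.
  have -> : (fun j => (-1)%:~R * t'' c j) = (fun j => - t'' c j).
    by apply/funext => j; rewrite mulN1r.
  by [].
set K := - 1 - (Qdeg c l0' - Qdeg c l0'' + s).
(* This involution replaces the mode [b] by the exponent of [z] left in the first factor once the
   power [z^{Q_c d/dQ_c}] is absorbed. *)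
have hbij : bijective (fun k : int => - 1 - Qdeg c l0' - k).
  by exists (fun k : int => - 1 - Qdeg c l0' - k) => k; ring.
rewrite -(vertex_residue P Q (t' c) (fun j => - t'' c j) K) mulr_fsumr.
apply: etrans (reindex_fsbigT _ _ hbij) _; apply: eq_fsbigr => k _.
rewrite FE GE.
have -> : - 1 - (- 1 - Qdeg c l0' - k) - Qdeg c l0' = k by ring.
have -> : - 1 - (- 1 - (- 1 - Qdeg c l0' - k) + s) + Qdeg c l0'' = K - k.
  by rewrite /K; ring.
by rewrite /F /G; ring.
Qed.

Lemma expansion_coef s b (T : int -> tpoly C) n : expansion s b T ->
  b@_(n + s, - n) = ((-1 : C) ^ (n * (n - 1) %/ 2)%Z) *: T n.
Proof.
case=> Tfin ->; rewrite (fsum_morph (mcoeff (n + s, - n))).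
  rewrite (fsbigTE [fset n]%fset) => [|k].
    by rewrite big_seq_fset1 /= mcoeffUU.
  rewrite inE => /negPf nk.
  by rewrite /= mcoeffU xpair_eqE eqr_opp nk andbF.
exists (fset_set [set k | T k != 0]%classic) => k.
rewrite in_fset_set // => /negP kT; have -> : T k = 0.
  by apply: contrapT => /eqP Tk; apply: kT; rewrite inE.
by rewrite scaler0 monalgU0.
Qed.

Definition expansion_sign (n : int) : C := (-1) ^ (n * (n - 1) %/ 2)%Z.

Let N1 : (-1 : C) != 0. Proof. by rewrite oppr_eq0 oner_eq0. Qed.

Lemma expansion_signS n : expansion_sign (n + 1) = expansion_sign n * (-1) ^ n.
Proof.
rewrite [RHS]mulrC /expansion_sign -expfzDr //; congr (_ ^ _).
by rewrite -divzMDl //; congr (_ %/ _)%Z; ring.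
Qed.

Lemma signz_sqr n : (-1) ^ n * (-1) ^ n = 1 :> C.
Proof. by rewrite -expfzMl mulrNN mulr1 exp1rz. Qed.

(** The component 2 involves the neighbours [n + 1] and [k - 1], whose signs differ from those at
    [n] and [k] by [(-1)^n] and [(-1)^(k-1)]. *)
Lemma expansion_sign_pair n k :
  expansion_sign (n + 1) * expansion_sign (k - 1)
  = - ((-1) ^ (n + k)) * (expansion_sign n * expansion_sign k).
Proof.
have -> : expansion_sign k = expansion_sign (k - 1) * (-1) ^ (k - 1).
  by rewrite -expansion_signS subrK.
have -> : (-1) ^ (n + k) = - ((-1) ^ n * (-1) ^ (k - 1)) :> C.
  have -> : n + k = n + (k - 1) + 1 by ring.
  by rewrite expfzDr // expr1z mulrN1 expfzDr.
rewrite expansion_signS opprK.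
transitivity (expansion_sign n * (-1) ^ n * expansion_sign (k - 1)
  * ((-1) ^ (k - 1) * (-1) ^ (k - 1))); first by rewrite signz_sqr mulr1.
by ring.
Qed.

(** In component 1 the [+] fermion raises the power of [Q_1], so the chosen coefficient of the first
    factor comes from [T n']. In component 2 it raises that of [Q_2], and the same coefficient comes
    from [T (n' + 1)]; likewise [n'' - 1] in the second factor. Moving [Q_2] past the powers of
    [Q_1] costs [(-1)^(n' + n'' + su + sv)], which with [expansion_sign_pair] leaves
    [- (-1)^(su + sv)]. *)
Lemma pairing_Omega_expansion (su sv s : int) (sc : bool -> int) u v
    (T T' : int -> tpoly C) n' n'' t' t'' :
  (forall c b, relabel M N c b + s = relabel M N c (b + sc c)) ->
  expansion su (sigma u) T -> expansion sv (sigma v) T' ->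
  pairing (boson_coef (n' + (su + 1), - n') t')
          (boson_coef (n'' + (sv - 1), - n'') t'') (Omega s (tens u v))
  = expansion_sign n' * expansion_sign n'' *
    (oint_R (n' - n'' + (su - sv) + sc false) (T n') (T' n'') t' t''
     - (-1) ^ (su + sv) *
       oint_r (n' - n'' - sc true) (T (n' + 1)) (T' (n'' - 1)) t' t'').
Proof.
move=> hsc uE vE; rewrite (pairing_Omega_comp M0 N0 _ _ _ _ hsc).
have E1 : (sigma u)@_(Qshift false (- 1) (n' + (su + 1), - n'))
    = expansion_sign n' *: T n'.
  rewrite -(expansion_coef n' uE) /Qshift /=; congr (_@_(_, _)); ring.
have E2 : (sigma v)@_(Qshift false 1 (n'' + (sv - 1), - n''))
    = expansion_sign n'' *: T' n''.
  rewrite -(expansion_coef n'' vE) /Qshift /=; congr (_@_(_, _)); ring.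
have E3 : (sigma u)@_(Qshift true (- 1) (n' + (su + 1), - n'))
    = expansion_sign (n' + 1) *: T (n' + 1).
  rewrite -(expansion_coef (n' + 1) uE) /Qshift /=; congr (_@_(_, _)); ring.
have E4 : (sigma v)@_(Qshift true 1 (n'' + (sv - 1), - n''))
    = expansion_sign (n'' - 1) *: T' (n'' - 1).
  rewrite -(expansion_coef (n'' - 1) vE) /Qshift /=; congr (_@_(_, _)); ring.
apply: etrans (f_equal2 +%R (vertex_pairing (sc false) t' t'' E1 E2)
                            (vertex_pairing (sc true) t' t'' E3 E4)) _.
rewrite mulrDr; congr (_ + _).
  rewrite /oint_R res_zinv_z /Qsign !mul1r; congr (_ * poly_pair _ _).
  by apply/funext => q; congr (in_z _ _); rewrite /=; ring.
rewrite /oint_r res_z_zinv expansion_sign_pair /Qsign /=.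
have -> : (-1) ^ (n' + (su + 1)) * (-1) ^ (n'' + (sv - 1))
    = (-1) ^ (n' + n'') * (-1) ^ (su + sv) :> C.
  by rewrite -!expfzDr //; congr (_ ^ _); ring.
rewrite -[X in _ = _ * X]mulNr; set z := (-1) ^ (n' + n'').
have -> : z * (-1) ^ (su + sv) * (- z * (expansion_sign n' * expansion_sign n''))
   = expansion_sign n' * expansion_sign n'' * - (-1) ^ (su + sv).
  transitivity (expansion_sign n' * expansion_sign n'' * - (-1) ^ (su + sv) * (z * z)).
    by ring.
  by rewrite signz_sqr mulr1.
rewrite [RHS]mulrA; congr (_ * poly_pair _ _).
by apply/funext => q; congr (in_z _ _); rewrite /=; ring.
Qed.

Lemma pairing_tens_expansion (s1 s2 : int) u v (T T' : int -> tpoly C) n' n'' t' t'' :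
  expansion s1 (sigma u) T -> expansion s2 (sigma v) T' ->
  pairing (boson_coef (n' + s1, - n') t') (boson_coef (n'' + s2, - n'') t'')
    (tens u v)
  = expansion_sign n' * expansion_sign n'' * (teval t' (T n') * teval t'' (T' n'')).
Proof.
move=> uE vE; rewrite pairing_tens; try exact: scalar_determined.
by rewrite /boson_coef (expansion_coef _ uE) (expansion_coef _ vE) !tevalZ mulrACA.
Qed.

Lemma expansion_signI n k : injective ( *%R (expansion_sign n * expansion_sign k)).
Proof.
apply: mulfI; rewrite mulf_neq0 // expfz_neq0 //.
Qed.

End Bilinear.

Theorem mainTheorem3 (R : realType) (M N m : nat)
  (hM : (0 < M)%N) (hN : (0 < N)%N) (hm : (0 < m)%N)
  (sigma : fock R[i] -> boson R[i]) (hsigma : bosonization M N sigma)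
  (tau0 : fock R[i]) (tau1 taum1 : 'I_m -> fock R[i])
  (tau0_charge : has_charge 0 tau0)
  (tau1_charge : forall i, has_charge 1 (tau1 i))
  (taum1_charge : forall i, has_charge (-1) (taum1 i))
  (hOmega : Omega (M + N)%:Z (tens tau0 tau0)
            = \sum_(i < m) tens (tau1 i) (taum1 i))
  (hOmega1 : forall i, Omega 0 (tens tau0 (tau1 i)) = tens (tau1 i) tau0)
  (hOmegam1 : forall i, Omega 0 (tens (taum1 i) tau0) = tens tau0 (taum1 i))
  (T0 : int -> tpoly R[i]) (T1 Tm1 : 'I_m -> int -> tpoly R[i])
  (hT0 : expansion 0 (sigma tau0) T0)
  (hT1 : forall i, expansion 1 (sigma (tau1 i)) (T1 i))
  (hTm1 : forall i, expansion (-1) (sigma (taum1 i)) (Tm1 i))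
  (n' n'' : int) (t' t'' : bool -> nat -> R[i]) (i : 'I_m) :
  [/\ oint_R (M%:Z + n' - n'') (T0 n') (T0 n'') t' t''
      = oint_r (- N%:Z + n' - n'') (T0 (n' + 1)) (T0 (n'' - 1)) t' t''
        + \sum_(l < m) teval t' (T1 l n')
                       * teval t'' (Tm1 l n''),
      oint_R (n' - n'' - 1) (T0 n') (T1 i n'') t' t''
      = - oint_r (n' - n'') (T0 (n' + 1)) (T1 i (n'' - 1)) t' t''
        + teval t' (T1 i n') * teval t'' (T0 n'')
    & oint_R (n' - n'' - 1) (Tm1 i n') (T0 n'') t' t''
      = - oint_r (n' - n'') (Tm1 i (n' + 1)) (T0 (n'' - 1)) t' t''
        + teval t' (T0 n') * teval t'' (Tm1 i n'')].
Proof.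
have shift0 c b : relabel M N c b + 0 = relabel M N c (b + (fun=> 0) c).
  by rewrite !addr0.
have per := relabel_period hM hN.
(* The charges on the right-hand sides must be written [su + 1] and [sv - 1] to match the
   coefficients taken on the left. *)
have ex b (T : int -> tpoly R[i]) s s' : s = s' -> expansion s b T -> expansion s' b T.
  by move=> ->.
split.
- have := pairing_Omega_expansion hM hN hsigma n' n'' t' t'' per hT0 hT0.
  rewrite hOmega raddf_sum /=.
  under eq_bigr => l _ do rewrite (pairing_tens_expansion hsigma _ _ _ _
    (ex _ _ _ (0 + 1) (erefl _) (hT1 l)) (ex _ _ _ (0 - 1) (erefl _) (hTm1 l))).
  rewrite -mulr_sumr => /expansion_signI.
  have -> : (-1) ^ (0 + 0) = 1 :> R[i] by [].
  rewrite mul1r => e; rewrite [RHS]addrC e.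
  have -> : M%:Z + n' - n'' = n' - n'' + (0 - 0) + period M N false.
    by rewrite /period; ring.
  have -> : - N%:Z + n' - n'' = n' - n'' - period M N true.
    by rewrite /period; ring.
  by rewrite subrK.
- have := pairing_Omega_expansion hM hN hsigma n' n'' t' t'' shift0 hT0 (hT1 i).
  rewrite hOmega1 (pairing_tens_expansion hsigma _ _ _ _
    (ex _ _ _ (0 + 1) (erefl _) (hT1 i)) (ex _ _ _ (1 - 1) (erefl _) hT0)).
  move=> /expansion_signI.
  (* The sum of the two charges is odd here, so the integral over [C_r] has a plus sign on the left,
     hence a minus sign once moved to the right. *)
  have -> : (-1) ^ (0 + 1) = -1 :> R[i] by [].
  by rewrite mulN1r opprK subr0 addr0 sub0r => ->; rewrite [RHS]addrC addrK.
have := pairing_Omega_expansion hM hN hsigma n' n'' t' t'' shift0 (hTm1 i) hT0.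
rewrite hOmegam1 (pairing_tens_expansion hsigma _ _ _ _
  (ex _ _ _ (-1 + 1) (erefl _) hT0) (ex _ _ _ (0 - 1) (erefl _) (hTm1 i))).
move=> /expansion_signI.
have -> : (-1) ^ (-1 + 0) = -1 :> R[i] by rewrite addr0 exprN1 invrN1.
by rewrite mulN1r opprK !subr0 ?addr0 => ->; rewrite [RHS]addrC addrK.
Qed.
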